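(* Let $A,B,C,P,Q\in\mathbb{C}^{N\times N}$ be pairwise commuting matrices such that $B+sI$ and $C+sI$ are invertible for every integer $s\ge0$, and such that $P,Q$ are positive stable. Then for every $z\in\mathbb{C}$, $$\int_0^1 t^{P-I}(1-t)^{Q-I}\,{}_1F_2(A;B,C;zt)\,dt=\mathbf{B}(P,Q)\,{}_2F_3(A,P;B,C,P+Q;z),$$ and for every $z\in\mathbb{C}$ and every $s\in\mathbb{C}$ with $\Re(s)>0$, $$\int_0^\infty e^{-st}\,t^{P-I}\,{}_1F_2(A;B,C;zt)\,dt=\Gamma(P)\,s^{-P}\,{}_2F_2\left(A,P;B,C;\frac{z}{s}\right).$$
   Context: $I$ is the $N\times N$ identity matrix. A matrix is positive stable if all its eigenvalues have positive real part. For $M\in\mathbb{C}^{N\times N}$, $(M)_0=I$, $(M)_k=M(M+I)\cdots(M+(k-1)I)$ for $k\ge1$; $t^M=\exp(M\ln t)$ with the principal logarithm. For positive stable matrices, $\Gamma(P)=\int_0^\infty e^{-t}t^{P-I}\,dt$ and $\mathbf{B}(P,Q)=\int_0^1t^{P-I}(1-t)^{Q-I}\,dt$. For commuting matrices, ${}_1F_2(A;B,C;z)=\sum_{k\ge0}\frac{z^k}{k!}(A)_k[(B)_k]^{-1}[(C)_k]^{-1}$, ${}_2F_2(A,P;B,C;z)=\sum_{k\ge0}\frac{z^k}{k!}(A)_k(P)_k[(B)_k]^{-1}[(C)_k]^{-1}$ and ${}_2F_3(A,P;B,C,D;z)=\sum_{k\ge0}\frac{z^k}{k!}(A)_k(P)_k[(B)_k]^{-1}[(C)_k]^{-1}[(D)_k]^{-1}$.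 *)

(* Defs.v *)
From HB Require Import structures.
From mathcomp Require Import all_boot all_order all_algebra.
From mathcomp Require Import complex.
From mathcomp Require Import all_classical all_reals all_analysis.

Set Implicit Arguments.
Unset Strict Implicit.
Unset Printing Implicit Defensive.

Import Order.TTheory GRing.Theory Num.Theory.
Import numFieldNormedType.Exports.

Local Open Scope classical_set_scope.
Local Open Scope ring_scope.
Local Open Scope complex_scope.

(* The topology on ['M[R[i]]_N] is that of entrywise convergence. *)
Definition mxexp (R : realType) (N : nat) (M : 'M[R[i]]_N) : 'M[R[i]]_N :=
  limn (fun n : nat => \sum_(0 <= k < n) (k`!%:R)^-1 *: M ^+ k).

Definition cexp (R : realType) (z : R[i]) : R[i] :=
  (expR (complex.Re z))%:C * (cos (complex.Im z) +i* sin (complex.Im z)).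

(* Principal argument, with values in (-pi, pi] (junk value at 0). *)
Definition carg (R : realType) (z : R[i]) : R :=
  let theta := acos (complex.Re z / Normc.normc z) in
  if 0 <= complex.Im z then theta else - theta.

Definition cln (R : realType) (z : R[i]) : R[i] :=
  ln (Normc.normc z) +i* carg z.

(* w^M with the principal logarithm; [mxpow t%:C M] is t^M = exp(M ln t) for
   real t > 0, since then [cln t%:C = (ln t)%:C]. *)
Definition mxpow (R : realType) (N : nat) (w : R[i]) (M : 'M[R[i]]_N) :
    'M[R[i]]_N :=
  mxexp (cln w *: M).

Definition positive_stable (R : realType) (N : nat) (M : 'M[R[i]]_N) : Prop :=
  forall a : R[i], eigenvalue M a -> 0 < complex.Re a.

Definition mxpoch (R : realType) (N : nat) (M : 'M[R[i]]_N) (k : nat) :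
    'M[R[i]]_N :=
  \prod_(0 <= j < k) (M + j%:R%:M).

(* [mxhyp [:: A_1; ..; A_p] [:: B_1; ..; B_q] z] is pFq(A_1..A_p; B_1..B_q; z) *)
Definition mxhyp_term (R : realType) (N : nat) (As Bs : seq 'M[R[i]]_N)
    (z : R[i]) (k : nat) : 'M[R[i]]_N :=
  (z ^+ k / k`!%:R) *:
    (\prod_(A <- As) mxpoch A k * \prod_(B <- Bs) invmx (mxpoch B k)).

Definition mxhyp (R : realType) (N : nat) (As Bs : seq 'M[R[i]]_N)
    (z : R[i]) : 'M[R[i]]_N :=
  limn (fun n : nat => \sum_(0 <= k < n) mxhyp_term As Bs z k).

(* Lebesgue integrals of complex matrix-valued functions are taken entrywise,
   on real and imaginary parts. [mxintegral] is only meaningful for functions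
   satisfying [mxintegrable]. *)
Definition mxintegrable (R : realType) (N : nat) (D : set R)
    (F : R -> 'M[R[i]]_N) : Prop :=
  forall i j : 'I_N,
    (@lebesgue_measure R).-integrable D
      (fun t => (complex.Re (F t i j))%:E) /\
    (@lebesgue_measure R).-integrable D
      (fun t => (complex.Im (F t i j))%:E).

Definition mxintegral (R : realType) (N : nat) (D : set R)
    (F : R -> 'M[R[i]]_N) : 'M[R[i]]_N :=
  \matrix_(i, j)
    ((\int[@lebesgue_measure R]_(t in D) complex.Re (F t i j)) +i*
     (\int[@lebesgue_measure R]_(t in D) complex.Im (F t i j))).

Definition mxGamma (R : realType) (N : nat) (P : 'M[R[i]]_N) : 'M[R[i]]_N :=
  mxintegral `]0, +oo[ (fun t => (expR (- t))%:C *: mxpow t%:C (P - 1%:M)).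

Definition mxBeta (R : realType) (N : nat) (P Q : 'M[R[i]]_N) : 'M[R[i]]_N :=
  mxintegral `]0, 1[
    (fun t => mxpow t%:C (P - 1%:M) *m mxpow (1 - t)%:C (Q - 1%:M)).

(* Main.v *)
Require Import Defs.
From mathcomp Require Import all_boot all_order all_algebra.
From mathcomp Require Import complex.
From mathcomp Require Import all_classical all_reals all_analysis.
From mathcomp Require Import measurable_realfun.
From mathcomp Require Import ring lra.

(** Both identities are obtained by expanding the hypergeometric function under the
    integral sign, so that everything reduces to the moments [J_k] (integrals of
    [t^k E(t)]) of the kernel [E], which is [t^(P-1) (1-t)^(Q-1)] on ]0, 1[ and
    [exp (-s t) t^(P-1)] on ]0, +oo[.

    The kernels satisfy [E' = E L] with [L] rational in [t]. Integrating the
    derivative of [phi E] with [phi = t^(k+1) (1-t)], respectively [t^(k+1)], gives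
    [J_k (P + k) = J_(k+1) (P + Q + k)], respectively [J_k (P + k) = s J_(k+1)]
    ([moment_rec], [beta_moment], [laplace_moment]). Hence [J_k] is
    [J_0 (P)_k (P+Q)_k^-1], respectively [J_0 (P)_k s^-k], which are the factors by
    which the series on the two sides differ. For the first kernel [J_0] is [B(P, Q)]
    by definition. For the second, [J_0 = Gamma(P) s^-P] is obtained by moving [s]
    along the path [exp (x ln s)], [0 <= x <= 1]: differentiation under the integral
    sign and the recurrence for [k = 0] show that [J_0] satisfies a linear
    differential equation in [x] ([laplace_path], [laplace_base]).

    Positive stability enters only through the exponential decay of [exp (- x P)]
    ([positive_stable_decays]), which follows from the Cayley-Hamilton theorem by
    removing the eigenvalues one at a time ([decay_roots]). It makes [t^(P-1)]
    integrable at 0 and makes the boundary terms at finite end points vanish. It is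
    inherited by sums of commuting matrices, and it implies that [P + Q + k] is
    invertible ([decaysD], [decays_unit]).

    The exchange of sum and integral is dominated convergence ([mxhyp_integral]):
    the terms of 1F2 are bounded by [K c^k / k!^2], so that its partial sums at [z t]
    are bounded by [K exp (eps t)] for every [eps > 0] ([hyp_growth]), and the kernel
    multiplied by such a factor, with [eps] small, has an integrable majorant, found
    as a combination of derivatives of bounded functions
    ([integrable_antiderivative]).

    Matrices are measured by the sum of the moduli of their entries, which is
    submultiplicative, and identities between exponentials are deduced from
    uniqueness for linear differential equations ([mxexp_ode]). *)

Set Implicit Arguments.
Unset Strict Implicit.
Unset Printing Implicit Defensive.

Import Order.TTheory GRing.Theory Num.Theory.
Import numFieldNormedType.Exports.

Local Open Scope classical_set_scope.
Local Open Scope ring_scope.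
Local Open Scope complex_scope.

Notation normc := Normc.normc.

(** * The entrywise sum norm *)

Definition nrm {R : realType} {N : nat} (M : 'M[R[i]]_N) : R :=
  \sum_i \sum_j normc (M i j).

Section Norm.
Context {R : realType} {N : nat}.
Implicit Types (M : 'M[R[i]]_N) (z : R[i]).

Lemma normc_ge0 z : 0 <= normc z.
Proof. by case: z => a b; exact: sqrtr_ge0. Qed.

Lemma normcD z w : normc (z + w) <= normc z + normc w.
Proof. exact: le_normcD. Qed.

Lemma normc_real (x : R) : normc x%:C = `|x|.
Proof. by rewrite /= expr0n /= addr0 sqrtr_sqr. Qed.

Lemma normcX z n : normc (z ^+ n) = normc z ^+ n.
Proof.
by elim: n => [|n ih]; rewrite ?expr0 ?Normc.normc1// !exprS Normc.normcM ih.
Qed.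

Lemma normc_nat n : normc (n%:R : R[i]) = n%:R.
Proof. by rewrite -(rmorph_nat (real_complex R)) normc_real normr_nat. Qed.

Lemma Re_le_normc z : `|complex.Re z| <= normc z.
Proof.
by case: z => a b /=; rewrite -sqrtr_sqr ler_sqrt ?addr_ge0 ?sqr_ge0// lerDl sqr_ge0.
Qed.

Lemma Im_le_normc z : `|complex.Im z| <= normc z.
Proof.
by case: z => a b /=; rewrite -sqrtr_sqr ler_sqrt ?addr_ge0 ?sqr_ge0// lerDr sqr_ge0.
Qed.

Lemma normc_le_ReIm z : normc z <= `|complex.Re z| + `|complex.Im z|.
Proof.
case: z => a b /=; rewrite -[leRHS]ger0_norm ?addr_ge0// -sqrtr_sqr.
rewrite ler_sqrt ?sqr_ge0// sqrrD !real_normK ?num_real// lerD2r lerDl.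
by rewrite mulrn_wge0// mulr_ge0.
Qed.

Lemma normc_sum I (r : seq I) (P : pred I) (F : I -> R[i]) :
  normc (\sum_(i <- r | P i) F i) <= \sum_(i <- r | P i) normc (F i).
Proof.
elim/big_rec2: _ => [|i x y _ h]; first by rewrite Normc.normc0.
by apply: le_trans (normcD _ _) _; rewrite lerD2l.
Qed.

Lemma nrm_ge0 M : 0 <= nrm M.
Proof. by apply: sumr_ge0 => i _; apply: sumr_ge0 => j _; exact: normc_ge0. Qed.

Lemma normc_le_nrm M i j : normc (M i j) <= nrm M.
Proof.
rewrite /nrm (bigD1 i)//= (bigD1 j)//= -addrA lerDl addr_ge0//.
  by apply: sumr_ge0 => k _; exact: normc_ge0.
by apply: sumr_ge0 => k _; apply: sumr_ge0 => l _; exact: normc_ge0.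
Qed.

Lemma nrm_eq0 M : nrm M <= 0 -> M = 0.
Proof.
move=> h; apply/matrixP => i j; rewrite mxE; apply: Normc.eq0_normc.
by apply/eqP; rewrite eq_le normc_ge0 (le_trans (normc_le_nrm M i j)).
Qed.

Lemma nrm0 : nrm (0 : 'M[R[i]]_N) = 0.
Proof.
by rewrite /nrm big1// => i _; rewrite big1// => j _; rewrite mxE Normc.normc0.
Qed.

Lemma nrmN M : nrm (- M) = nrm M.
Proof. by apply: eq_bigr => i _; apply: eq_bigr => j _; rewrite mxE; exact: normcN. Qed.

Lemma nrmD M M' : nrm (M + M') <= nrm M + nrm M'.
Proof.
rewrite /nrm -big_split; apply: ler_sum => i _; rewrite -big_split.
by apply: ler_sum => j _; rewrite mxE; exact: normcD.
Qed.

Lemma nrmB M M' : nrm (M - M') <= nrm M + nrm M'.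
Proof. by apply: le_trans (nrmD _ _) _; rewrite nrmN. Qed.

Lemma nrmZ z M : nrm (z *: M) = normc z * nrm M.
Proof.
rewrite /nrm mulr_sumr; apply: eq_bigr => i _; rewrite mulr_sumr.
by apply: eq_bigr => j _; rewrite mxE Normc.normcM.
Qed.

Lemma nrm_sum I (r : seq I) (P : pred I) (F : I -> 'M[R[i]]_N) :
  nrm (\sum_(i <- r | P i) F i) <= \sum_(i <- r | P i) nrm (F i).
Proof.
elim/big_rec2: _ => [|i x y _ h]; first by rewrite nrm0.
by apply: le_trans (nrmD _ _) _; rewrite lerD2l.
Qed.

Lemma nrmM M M' : nrm (M *m M') <= nrm M * nrm M'.
Proof.
rewrite /nrm mulr_suml; apply: ler_sum => i _.
rewrite (@le_trans _ _ (\sum_j \sum_k normc (M i k) * normc (M' k j)))//.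
  apply: ler_sum => j _; rewrite mxE; apply: le_trans (normc_sum _ _ _) _.
  by apply: ler_sum => k _; rewrite Normc.normcM.
rewrite exchange_big mulr_suml; apply: ler_sum => k _ /=.
rewrite -mulr_sumr ler_wpM2l ?normc_ge0// [leRHS](bigD1 k)//= lerDl.
by apply: sumr_ge0 => l _; apply: sumr_ge0 => j _; exact: normc_ge0.
Qed.

Lemma nrm_le_ReIm M (e : R) :
  (forall i j, `|complex.Re (M i j)| <= e /\ `|complex.Im (M i j)| <= e) ->
  nrm M <= N%:R * (N%:R * (e + e)).
Proof.
have sumE (x : R) : N%:R * x = \sum_(i < N) x.
  by rewrite sumr_const card_ord mulr_natl.
move=> h; rewrite /nrm !sumE.
apply: ler_sum => i _; apply: ler_sum => j _.
by case: (h i j) => h1 h2; apply: le_trans (normc_le_ReIm _) _; rewrite lerD.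
Qed.

End Norm.

(** * Convergence of matrix sequences *)

(** A real-valued form of entrywise convergence, convenient for estimates;
    [mxcvg_lim] relates it to the limits of the topology. *)
Definition mxcvg {R : realType} {N : nat} (u : nat -> 'M[R[i]]_N) (L : 'M[R[i]]_N) :=
  nrm (u n - L) @[n --> \oo] --> (0 : R).

Lemma cvg_sumr {R : realType} {T : Type} {F : set_system T} {FF : Filter F} I
    (r : seq I) (f : I -> T -> R) (a : I -> R) :
  (forall i, f i x @[x --> F] --> a i) ->
  (\sum_(i <- r) f i x) @[x --> F] --> \sum_(i <- r) a i.
Proof.
move=> h; elim: r => [|i r ih].
  by rewrite big_nil; under eq_fun do rewrite big_nil; exact: cvg_cst.
by rewrite big_cons; under eq_fun do rewrite big_cons; exact: cvgD.
Qed.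

Section Cvg.
Context {R : realType} {N : nat}.
Implicit Types (u : nat -> 'M[R[i]]_N) (L M : 'M[R[i]]_N).

Lemma mxcvg_lim u L : mxcvg u L ->
  lim ((u n : ('M[R[i] : numFieldType]_N : normedModType R[i])) @[n --> \oo]) = L.
Proof.
move=> h; apply/cvg_lim; first exact: norm_hausdorff.
apply/cvgrPdist_le => eps eps0.
have [e0 epsE] : 0 < complex.Re eps /\ eps = (complex.Re eps)%:C.
  by move: eps eps0 => [a b]; rewrite ltcE /= => /andP[/eqP -> ?]; split.
have /cvgrPdist_le/(_ _ e0) := h; apply: filterS => n.
rewrite sub0r normrN (ger0_norm (nrm_ge0 _)) => hn.
rewrite -(opprB (u n) L) normrN.
have {}hn : forall i j, `|(u n - L) i j| <= eps.
  move=> i j; rewrite epsE.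
  have -> : `|(u n - L) i j| = (normc ((u n - L) i j))%:C by [].
  by rewrite lecR (le_trans (normc_le_nrm _ _ _)).
have [|] := eqVneq (mx_norm (u n - L)) 0.
  by move=> E; rewrite [X in X <= _]E ltW.
by move=> /mx_norm_neq0[[i j] E]; rewrite [X in X <= _]E.
Qed.

Lemma mxcvgP u L :
  (forall i j, complex.Re (u n i j) @[n --> \oo] --> complex.Re (L i j) /\
    complex.Im (u n i j) @[n --> \oo] --> complex.Im (L i j)) -> mxcvg u L.
Proof.
move=> h.
have lim0 : (\sum_i \sum_j (`|complex.Re (u n i j) - complex.Re (L i j)| +
      `|complex.Im (u n i j) - complex.Im (L i j)|)) @[n --> \oo] --> (0 : R).
  have -> : nbhs (0 : R) = nbhs (\sum_(i < N) \sum_(j < N) (0 + 0) : R).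
    by rewrite big1// => i _; rewrite big1// => j _; rewrite addr0.
  apply: cvg_sumr => i; apply: cvg_sumr => j.
  have [h1 h2] := h i j.
  apply: cvgD; rewrite -(@normr0 _ R).
    by apply: cvg_norm; apply/subr_cvg0.
  by apply: cvg_norm; apply/subr_cvg0.
apply: squeeze_cvgr lim0; last exact: cvg_cst.
apply: nearW => n; rewrite nrm_ge0 /= /nrm; apply: ler_sum => i _.
apply: ler_sum => j _; apply: le_trans (normc_le_ReIm _) _.
by rewrite !mxE !raddfB.
Qed.

End Cvg.

Section Series.
Context {R : realType} {N : nat}.
Implicit Types (u v : nat -> 'M[R[i]]_N) (L M : 'M[R[i]]_N).

Lemma mxcvg_lip u v L M (c : R) : mxcvg u L ->
  (forall n, nrm (v n - M) <= c * nrm (u n - L)) -> mxcvg v M.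
Proof.
move=> h le_c; rewrite /mxcvg.
have h' : c * nrm (u n - L) @[n --> \oo] --> (0 : R).
  by rewrite -[X in _ --> X](mulr0 c); apply: cvgM => //; exact: cvg_cst.
apply: squeeze_cvgr h'; last exact: cvg_cst.
by apply: nearW => n; rewrite nrm_ge0 le_c.
Qed.

Lemma mxcvg_mull M u L : mxcvg u L -> mxcvg (fun n => M *m u n) (M *m L).
Proof. by move/mxcvg_lip; apply => n; rewrite -mulmxBr; exact: nrmM. Qed.

Lemma mxcvg_mulr M u L : mxcvg u L -> mxcvg (fun n => u n *m M) (L *m M).
Proof.
by move/mxcvg_lip; apply => n; rewrite -mulmxBl mulrC; exact: nrmM.
Qed.

Lemma mxcvg_Re u L i j : mxcvg u L ->
  complex.Re (u n i j) @[n --> \oo] --> complex.Re (L i j).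
Proof.
move=> h; apply/cvgrPdist_le => e e0.
have /cvgrPdist_le/(_ _ e0) := h; apply: filterS => n.
rewrite sub0r normrN (ger0_norm (nrm_ge0 _)) => /(le_trans _); apply.
rewrite distrC -raddfB; apply: le_trans (Re_le_normc _) _.
by have := normc_le_nrm (u n - L) i j; rewrite !mxE.
Qed.

Lemma mxcvg_Im u L i j : mxcvg u L ->
  complex.Im (u n i j) @[n --> \oo] --> complex.Im (L i j).
Proof.
move=> h; apply/cvgrPdist_le => e e0.
have /cvgrPdist_le/(_ _ e0) := h; apply: filterS => n.
rewrite sub0r normrN (ger0_norm (nrm_ge0 _)) => /(le_trans _); apply.
rewrite distrC -raddfB; apply: le_trans (Im_le_normc _) _.
by have := normc_le_nrm (u n - L) i j; rewrite !mxE.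
Qed.

Lemma mxcvg_unique u L M : mxcvg u L -> mxcvg u M -> L = M.
Proof. by move=> /mxcvg_lim <- /mxcvg_lim <-. Qed.

(** Absolute convergence, read off entrywise from the completeness of the reals. *)
Lemma mxseries_cvg u (a : nat -> R) : (forall k, nrm (u k) <= a k) ->
  cvgn (series a) -> exists L, mxcvg (fun n => \sum_(0 <= k < n) u k) L.
Proof.
move=> ua ca.
have dom (f : nat -> R) : (forall k, `|f k| <= a k) -> cvgn (series f).
  move=> fa; apply: normed_cvg; apply: series_le_cvg ca => // n; first exact: normr_ge0.
  exact: le_trans (normr_ge0 _) (fa n).
exists (\matrix_(i, j) (limn (series (fun k => complex.Re (u k i j))) +i*
                        limn (series (fun k => complex.Im (u k i j))))).
apply: mxcvgP => i j; rewrite mxE /=; split.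
- under eq_fun do rewrite summxE raddf_sum.
  apply: (dom (fun k => complex.Re (u k i j))) => k; apply: le_trans (ua k).
  exact: le_trans (Re_le_normc _) (normc_le_nrm _ _ _).
- under eq_fun do rewrite summxE raddf_sum.
  apply: (dom (fun k => complex.Im (u k i j))) => k; apply: le_trans (ua k).
  exact: le_trans (Im_le_normc _) (normc_le_nrm _ _ _).
Qed.

End Series.

(** * Derivatives along a real variable *)

(** Complex functions of a real variable are differentiated on real and imaginary
    parts, and matrices entry by entry, so that the product rule for matrices is
    the one for real functions, summed. *)
Definition cder {R : realType} (f : R -> R[i]) (x : R) (d : R[i]) :=
  is_derive x (1 : R) (fun t => complex.Re (f t)) (complex.Re d) /\
  is_derive x (1 : R) (fun t => complex.Im (f t)) (complex.Im d).

Definition mxder {R : realType} {N : nat} (F : R -> 'M[R[i]]_N) (x : R)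
    (D : 'M[R[i]]_N) :=
  forall i j, cder (fun t => F t i j) x (D i j).

Section Deriv.
Context {R : realType} {N : nat}.
Implicit Types (f g : R -> R[i]) (F G : R -> 'M[R[i]]_N) (x : R).

Lemma cder_cst (c : R[i]) x : cder (fun=> c) x 0.
Proof. by split; exact: is_derive_cst. Qed.

Lemma cder_real (h : R -> R) x d : is_derive x (1 : R) h d ->
  cder (fun t => (h t)%:C) x d%:C.
Proof. by split => //=; exact: is_derive_cst. Qed.

Lemma cderD f g x df dg : cder f x df -> cder g x dg ->
  cder (fun t => f t + g t) x (df + dg).
Proof.
move=> [f1 f2] [g1 g2]; split.
  rewrite raddfD; under eq_fun do rewrite raddfD; exact: is_deriveD.
rewrite raddfD; under eq_fun do rewrite raddfD; exact: is_deriveD.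
Qed.

Lemma Re_add (z w : R[i]) : complex.Re (z + w) = complex.Re z + complex.Re w.
Proof. exact: raddfD. Qed.

Lemma Im_add (z w : R[i]) : complex.Im (z + w) = complex.Im z + complex.Im w.
Proof. exact: raddfD. Qed.

Lemma Re_mul (z w : R[i]) : complex.Re (z * w) =
  complex.Re z * complex.Re w - complex.Im z * complex.Im w.
Proof. by case: z w => a b [c d]. Qed.

Lemma Im_mul (z w : R[i]) : complex.Im (z * w) =
  complex.Re z * complex.Im w + complex.Im z * complex.Re w.
Proof. by case: z w => a b [c d]. Qed.

Lemma cderM f g x df dg : cder f x df -> cder g x dg ->
  cder (fun t => f t * g t) x (df * g x + f x * dg).
Proof.
move=> [f1 f2] [g1 g2]; split.
  under eq_fun do rewrite Re_mul.
  apply: is_derive_eq; rewrite Re_add !Re_mul /GRing.scale /=; ring.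
under eq_fun do rewrite Im_mul.
apply: is_derive_eq; rewrite Im_add !Im_mul /GRing.scale /=; ring.
Qed.

Lemma cder_sum I (r : seq I) (f : I -> R -> R[i]) (d : I -> R[i]) x :
  (forall i, cder (f i) x (d i)) ->
  cder (fun t => \sum_(i <- r) f i t) x (\sum_(i <- r) d i).
Proof.
move=> h; elim: r => [|i r ih].
  by rewrite big_nil; under eq_fun do rewrite big_nil; exact: cder_cst.
by rewrite big_cons; under eq_fun do rewrite big_cons; exact: cderD.
Qed.

Lemma cder_comp f (h : R -> R) x d e : cder f (h x) d ->
  is_derive x (1 : R) h e -> cder (fun t => f (h t)) x (e%:C * d).
Proof.
move=> [f1 f2] dh; split.
  rewrite Re_mul /= mul0r subr0 mulrC; exact: (is_derive1_comp f1 dh).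
rewrite Im_mul /= mul0r addr0 mulrC; exact: (is_derive1_comp f2 dh).
Qed.

Lemma cder_eq f x d d' : cder f x d -> d = d' -> cder f x d'.
Proof. by move=> ? <-. Qed.

Lemma mxder_eq F x D D' : mxder F x D -> D = D' -> mxder F x D'.
Proof. by move=> ? <-. Qed.

Lemma mxder_cst (M : 'M[R[i]]_N) x : mxder (fun=> M) x 0.
Proof. by move=> i j; rewrite mxE; exact: cder_cst. Qed.

Lemma mxderD F G x DF DG : mxder F x DF -> mxder G x DG ->
  mxder (fun t => F t + G t) x (DF + DG).
Proof.
by move=> hF hG i j; rewrite mxE; under eq_fun do rewrite mxE; exact: cderD.
Qed.

Lemma mxderM F G x DF DG : mxder F x DF -> mxder G x DG ->
  mxder (fun t => F t *m G t) x (DF *m G x + F x *m DG).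
Proof.
move=> hF hG i j; rewrite !mxE -big_split /=; under eq_fun do rewrite mxE.
by apply: cder_sum => k; exact: cderM.
Qed.

Lemma mxderZ f F x df DF : cder f x df -> mxder F x DF ->
  mxder (fun t => f t *: F t) x (df *: F x + f x *: DF).
Proof.
by move=> hf hF i j; rewrite !mxE; under eq_fun do rewrite mxE; exact: cderM.
Qed.

Lemma mxder_comp F (h : R -> R) x D e : mxder F (h x) D ->
  is_derive x (1 : R) h e -> mxder (fun t => F (h t)) x (e%:C *: D).
Proof. by move=> hF dh i j; rewrite mxE; exact: cder_comp (hF i j) dh. Qed.

Lemma is_derive_continuous (h : R -> R) x d : is_derive x (1 : R) h d ->
  {for x, continuous h}.
Proof.
move=> [dh _]; apply: differentiable_continuous; exact/derivable1_diffP.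
Qed.

Lemma mxder0_eq F : (forall x, 0 <= x <= 1 -> mxder F x 0) -> F 1 = F 0.
Proof.
move=> h.
have cst0 (g : R -> R) : (forall x, 0 <= x <= 1 -> is_derive x (1 : R) g 0) ->
    g 1 = g 0.
  move=> dg; apply/eqP; rewrite -subr_eq0.
  have [||c _ ->] := @MVT R g (fun=> 0) 0 1 ltr01; last by rewrite mul0r.
    by move=> x; rewrite in_itv /= => /andP[x0 x1]; apply: dg; rewrite !ltW.
  apply: derivable_within_continuous => x; rewrite in_itv /= => x01.
  by case: (dg x x01).
apply/matrixP => i j; apply/eqP; rewrite eq_complex.
have -> : complex.Re (F 1 i j) = complex.Re (F 0 i j).
  by apply: (cst0 (fun t => complex.Re (F t i j))) => x /h/(_ i j)[]; rewrite mxE.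
have -> : complex.Im (F 1 i j) = complex.Im (F 0 i j).
  by apply: (cst0 (fun t => complex.Im (F t i j))) => x /h/(_ i j)[]; rewrite mxE.
by rewrite !eqxx.
Qed.

End Deriv.

(** * The matrix exponential *)

Lemma expR_partial_le {R : realType} (x : R) n : 0 <= x ->
  \sum_(0 <= k < n) x ^+ k / k`!%:R <= expR x.
Proof.
move=> x0.
apply: (@nondecreasing_cvgn_le _ (series (exp_coeff x))); last exact: is_cvg_series_exp_coeff.
by apply: nondecreasing_series => k _ _; rewrite divr_ge0// exprn_ge0.
Qed.

Section MxExp.
Context {R : realType} {N : nat}.
Implicit Types (M V : 'M[R[i]]_N) (x : R).

Lemma nrm_exp M k : nrm (M ^+ k) <= nrm (1%:M : 'M[R[i]]_N) * nrm M ^+ k.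
Proof.
elim: k => [|k ih]; first by rewrite !expr0 mulr1.
rewrite !exprSr mulrA; apply: le_trans (nrmM _ _) _.
by rewrite ler_wpM2r ?nrm_ge0.
Qed.

Lemma nrm_exp_term M k : nrm ((k`!%:R)^-1 *: M ^+ k) <=
  nrm (1%:M : 'M[R[i]]_N) * (nrm M ^+ k / k`!%:R).
Proof.
rewrite nrmZ Normc.normcV normc_nat mulrC mulrA ler_wpM2r ?invr_ge0//.
exact: nrm_exp.
Qed.

Lemma mxexp_cvg M :
  mxcvg (fun n => \sum_(0 <= k < n) (k`!%:R)^-1 *: M ^+ k) (mxexp M).
Proof.
have [|L hL] := @mxseries_cvg _ _ (fun k => (k`!%:R)^-1 *: M ^+ k) _ (nrm_exp_term M).
  exact: is_cvg_seriesZ (is_cvg_series_exp_coeff _).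
by rewrite /mxexp (mxcvg_lim hL).
Qed.

Lemma mxcvg_nrm_le (u : nat -> 'M[R[i]]_N) L b : mxcvg u L ->
  (forall n, nrm (u n) <= b) -> nrm L <= b.
Proof.
move=> h ub; apply/ler_addgt0Pr => e e0.
have /cvgrPdist_le/(_ _ e0)[n _ /(_ n (leqnn n))] := h.
rewrite sub0r normrN (ger0_norm (nrm_ge0 _)) => hn.
rewrite (_ : L = u n - (u n - L)); last by rewrite opprB addrC subrK.
by apply: le_trans (nrmB _ _) _; rewrite lerD.
Qed.

Lemma nrm_mxexp M : nrm (mxexp M) <= nrm (1%:M : 'M[R[i]]_N) * expR (nrm M).
Proof.
apply: mxcvg_nrm_le (mxexp_cvg M) _ => n; apply: le_trans (nrm_sum _ _ _) _.
apply: le_trans (ler_sum _ (fun k _ => nrm_exp_term M k)) _.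
by rewrite -mulr_sumr ler_wpM2l ?nrm_ge0// expR_partial_le ?nrm_ge0.
Qed.

Lemma mxexp_comm M V : comm_mx V M -> comm_mx V (mxexp M).
Proof.
move=> cVM; have h1 := mxcvg_mull V (mxexp_cvg M); have h2 := mxcvg_mulr V (mxexp_cvg M).
apply: mxcvg_unique h1 _; congr (mxcvg _ _): h2; apply/funext => n.
apply/esym/comm_mx_sum => k _; rewrite /comm_mx -scalemxAl -scalemxAr.
by congr (_ *: _); rewrite -[_ *m _]/(_ * _); apply: commrX.
Qed.

(** Termwise differentiation of the power series of the entries. *)
Lemma mxder_exp V M x :
  mxder (fun t => V *m mxexp (t%:C *: M)) x (V *m M *m mxexp (x%:C *: M)).
Proof.
move=> i j.
pose co W k := (W *m ((k`!%:R)^-1 *: M ^+ k)) i j.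
have termE W (t : R) k :
    (W *m ((k`!%:R)^-1 *: (t%:C *: M) ^+ k)) i j = (t ^+ k)%:C * co W k.
  rewrite /co; suff -> : (t%:C *: M) ^+ k = (t ^+ k)%:C *: M ^+ k.
    by rewrite scalerA [X in X *: _]mulrC -scalerA -scalemxAr [LHS]mxE.
  elim: k => [|k ih]; first by rewrite !expr0 scale1r.
  rewrite !exprS ih rmorphM -[_ * _]/(_ *m _) -[M * _]/(M *m _).
  by rewrite -scalemxAl -scalemxAr scalerA.
have scE c (X : 'M[R[i]]_N) : (c *: X) i j = c * X i j by rewrite mxE.
have diffs W k : k.+1%:R * co W k.+1 = co (W *m M) k.
  rewrite /co exprS -[M * _]/(M *m _) -!scalemxAr mulmxA !scE mulrA.
  rewrite factS natrM invfM mulrA.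
  by rewrite mulfV ?mul1r ?pnatr_eq0.
have real_mul (a : R) z : complex.Re (a%:C * z) = a * complex.Re z /\
    complex.Im (a%:C * z) = a * complex.Im z.
  by case: z => b c; rewrite /= !mul0r subr0 addr0.
have ReE W t : pseries (fun k => complex.Re (co W k)) t @ \oo -->
    complex.Re ((W *m mxexp (t%:C *: M)) i j).
  have := @mxcvg_Re _ _ _ _ i j (mxcvg_mull W (mxexp_cvg (t%:C *: M))).
  apply: cvg_trans; apply: near_eq_cvg; apply: nearW => n; apply/esym.
  rewrite mulmx_sumr summxE raddf_sum; apply: eq_bigr => k _.
  by rewrite termE; exact: etrans (mulrC _ _) (esym (proj1 (real_mul _ _))).
have ImE W t : pseries (fun k => complex.Im (co W k)) t @ \oo -->
    complex.Im ((W *m mxexp (t%:C *: M)) i j).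
  have := @mxcvg_Im _ _ _ _ i j (mxcvg_mull W (mxexp_cvg (t%:C *: M))).
  apply: cvg_trans; apply: near_eq_cvg; apply: nearW => n; apply/esym.
  rewrite mulmx_sumr summxE raddf_sum; apply: eq_bigr => k _.
  by rewrite termE; exact: etrans (mulrC _ _) (esym (proj2 (real_mul _ _))).
have dRe W : pseries_diffs (fun k => complex.Re (co W k)) =
    (fun k => complex.Re (co (W *m M) k)).
  apply/funext => k; rewrite /pseries_diffs -diffs -(rmorph_nat (real_complex R)).
  by case: (real_mul k.+1%:R (co W k.+1)) => ->.
have dIm W : pseries_diffs (fun k => complex.Im (co W k)) =
    (fun k => complex.Im (co (W *m M) k)).
  apply/funext => k; rewrite /pseries_diffs -diffs -(rmorph_nat (real_complex R)).
  by case: (real_mul k.+1%:R (co W k.+1)) => _ ->.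
have xlt : `|x| < `| `|x| + 1 | by rewrite [ltRHS]ger0_norm ?addr_ge0// ltrDl.
split.
- rewrite (_ : (fun t => _) = fun t => limn (pseries (fun k => complex.Re (co V k)) t)).
    rewrite -(cvg_lim _ (ReE (V *m M) x))// -dRe.
    apply: (@pseries_snd_diffs _ _ (`|x| + 1)) => //; rewrite ?dRe; exact: (cvgP _ (ReE _ _)).
  by apply/funext => t; rewrite (cvg_lim _ (ReE V t)).
- rewrite (_ : (fun t => _) = fun t => limn (pseries (fun k => complex.Im (co V k)) t)).
    rewrite -(cvg_lim _ (ImE (V *m M) x))// -dIm.
    apply: (@pseries_snd_diffs _ _ (`|x| + 1)) => //; rewrite ?dIm; exact: (cvgP _ (ImE _ _)).
  by apply/funext => t; rewrite (cvg_lim _ (ImE V t)).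
Qed.

Lemma mxder_exp1 M x :
  mxder (fun t => mxexp (t%:C *: M)) x (M *m mxexp (x%:C *: M)).
Proof.
have := mxder_exp 1%:M M x; rewrite mul1mx.
by under [X in mxder X]eq_fun do rewrite mul1mx.
Qed.

Lemma mxexp0 : mxexp (0 : 'M[R[i]]_N) = 1%:M.
Proof.
apply: mxcvg_unique (mxexp_cvg 0) _; rewrite /mxcvg.
apply: cvg_near_cst.
exists 1%N => // -[|n] //= _.
rewrite big_nat_recl// expr0 fact0 invr1 scale1r big1 ?addr0 ?subrr ?nrm0//.
by move=> k _; rewrite expr0n /= scaler0.
Qed.

Lemma comm_mxexpZ M x : comm_mx M (mxexp (x%:C *: M)).
Proof.
by apply: mxexp_comm; rewrite /comm_mx -scalemxAl -scalemxAr.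
Qed.

Lemma mxexpN M : mxexp (- M) *m mxexp M = 1%:M.
Proof.
pose F (t : R) := mxexp (t%:C *: - M) *m mxexp (t%:C *: M).
have F0 : F 0 = 1%:M by rewrite /F !scale0r mxexp0 mulmx1.
have F1 : F 1 = mxexp (- M) *m mxexp M by rewrite /F !scale1r.
rewrite -F0 -F1; apply: mxder0_eq => x _.
apply: mxder_eq (mxderM (mxder_exp1 (- M) x) (mxder_exp1 M x)) _.
by rewrite mulmxA (comm_mxexpZ (- M) x) -mulmxDl mulmxN addNr mul0mx.
Qed.
(** The product [H(x) exp (- x M)] has derivative zero. The identities between
    exponentials below are instances, each with its own choice of [H]. *)
Lemma mxexp_ode M (H : R -> 'M[R[i]]_N) :
  (forall x, 0 <= x <= 1 -> mxder H x (H x *m M)) -> H 1 = H 0 *m mxexp M.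
Proof.
move=> dH.
have : H 1 *m mxexp ((1 : R)%:C *: - M) = H 0 *m mxexp ((0 : R)%:C *: - M).
  apply: (mxder0_eq (F := fun t => H t *m mxexp (t%:C *: - M))) => x x01.
  apply: mxder_eq (mxderM (dH x x01) (mxder_exp1 (- M) x)) _.
  by rewrite mulNmx mulmxN mulmxA subrr.
rewrite scale0r mxexp0 mulmx1 scale1r => <-.
by rewrite -mulmxA mxexpN mulmx1.
Qed.

Lemma mxexpD M V : comm_mx M V -> mxexp (M + V) = mxexp M *m mxexp V.
Proof.
move=> cMV.
pose F (t : R) := mxexp (t%:C *: M) *m mxexp (t%:C *: V).
have F0 : F 0 = 1%:M by rewrite /F !scale0r mxexp0 mulmx1.
have F1 : F 1 = mxexp M *m mxexp V by rewrite /F !scale1r.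
rewrite -F1 -[LHS]mul1mx -F0; apply/esym/mxexp_ode => x _.
apply: mxder_eq (mxderM (mxder_exp1 M x) (mxder_exp1 V x)) _.
have c1 : comm_mx M (mxexp (x%:C *: V)).
  by apply: mxexp_comm; rewrite /comm_mx -scalemxAl -scalemxAr cMV.
have c2 := comm_mxexpZ M x; have c3 := comm_mxexpZ V x; rewrite /F.
move: (mxexp (x%:C *: M)) (mxexp (x%:C *: V)) c1 c2 c3 => E1 E2 c1 c2 c3.
by rewrite c2 c3 mulmxDr -!mulmxA c1.
Qed.

End MxExp.

(** * Scalar exponentials *)

Section Scalar.
Context {R : realType}.
Implicit Types (z w : R[i]) (x : R).

Lemma cexpE z :
  cexp z = (expR (complex.Re z) * cos (complex.Im z)) +i*
           (expR (complex.Re z) * sin (complex.Im z)).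
Proof. by rewrite /cexp; simpc. Qed.

Lemma cexp_real x : cexp x%:C = (expR x)%:C.
Proof. by rewrite cexpE /= cos0 sin0 mulr1 mulr0. Qed.

Lemma cexp0 : cexp (0 : R[i]) = 1.
Proof. by rewrite (cexp_real 0) expR0. Qed.

Lemma normc_cexp z : normc (cexp z) = expR (complex.Re z).
Proof.
by rewrite cexpE /= !exprMn -mulrDr cos2Dsin2 mulr1 sqrtr_sqr ger0_norm ?expR_ge0.
Qed.

Lemma cder_cexp z x : cder (fun t => cexp (t%:C * z)) x (z * cexp (x%:C * z)).
Proof.
have E t : cexp (t%:C * z) =
    (expR (t * complex.Re z) * cos (t * complex.Im z)) +i*
    (expR (t * complex.Re z) * sin (t * complex.Im z)).
  by rewrite cexpE Re_mul Im_mul /= !mul0r subr0 addr0.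
split.
  rewrite E; under eq_fun do rewrite E.
  rewrite Re_mul /=; apply: is_derive_eq; rewrite /GRing.scale /=; ring.
rewrite E; under eq_fun do rewrite E.
rewrite Im_mul /=; apply: is_derive_eq; rewrite /GRing.scale /=; ring.
Qed.

End Scalar.

Lemma mxexp_addscalar {R : realType} {N : nat} (M : 'M[R[i]]_N) (z : R[i]) :
  mxexp (M + z%:M) = cexp z *: mxexp M.
Proof.
pose F (t : R) := cexp (t%:C * z) *: mxexp (t%:C *: M).
have F0 : F 0 = 1%:M.
  by rewrite /F (_ : (0 : R)%:C = 0)// mul0r scale0r mxexp0 cexp0 scale1r.
have F1 : F 1 = cexp z *: mxexp M by rewrite /F mul1r scale1r.
rewrite -F1 -[LHS]mul1mx -F0; apply/esym/mxexp_ode => x _.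
apply: mxder_eq (mxderZ (cder_cexp z x) (mxder_exp1 M x)) _.
have c2 := comm_mxexpZ M x; rewrite /F.
move: (mxexp (x%:C *: M)) c2 => E c2.
rewrite c2 mulmxDr mul_mx_scalar -!scalemxAl scalerA addrC.
by rewrite -scalerA.
Qed.

(** * Decay of the exponential of a positive stable matrix *)

Lemma derive_ge0_le {R : realType} (h h' : R -> R) x :
  (forall y : R, 0 <= y -> is_derive y (1 : R) h (h' y)) ->
  (forall y, 0 <= y -> 0 <= h' y) -> 0 <= x -> h 0 <= h x.
Proof.
move=> dh h0; rewrite le_eqVlt => /predU1P[<-//|x0]; rewrite -subr_ge0.
have [||c] := @MVT R h h' 0 x x0.
- by move=> y; rewrite in_itv /= => /andP[y0 _]; apply: dh; exact: ltW.
- apply: derivable_within_continuous => y; rewrite in_itv /= => /andP[y0 _].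
  by case: (dh y y0).
- rewrite in_itv /= => /andP[c0 _] ->.
  by rewrite mulr_ge0 ?subr_ge0 ?h0 ?ltW.
Qed.

Lemma derive_le_incr {R : realType} (f f' g g' : R -> R) :
  (forall x : R, 0 <= x -> is_derive x (1 : R) f (f' x)) ->
  (forall x : R, 0 <= x -> is_derive x (1 : R) g (g' x)) ->
  (forall x, 0 <= x -> `|f' x| <= g' x) ->
  forall x, 0 <= x -> `|f x - f 0| <= g x - g 0.
Proof.
move=> df dg fg x x0.
have fg' y : 0 <= y -> - g' y <= f' y <= g' y by move=> /fg; rewrite ler_norml.
have sum0 : g 0 + f 0 <= g x + f x.
  apply: (@derive_ge0_le _ (g + f) (fun y => g' y + f' y)) => // y y0.
    exact: is_deriveD (dg y y0) (df y y0).
  by have /andP[] := fg' y y0; lra.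
have diff0 : g 0 - f 0 <= g x - f x.
  apply: (@derive_ge0_le _ (g - f) (fun y => g' y - f' y)) => // y y0.
    exact: is_deriveB (dg y y0) (df y y0).
  by have /andP[] := fg' y y0; lra.
by rewrite ler_norml; apply/andP; split; lra.
Qed.

Section Decay.
Context {R : realType} {N : nat}.
Implicit Types (M P V : 'M[R[i]]_N) (a K x : R).

Lemma mxder_nrm_le (F F' : R -> 'M[R[i]]_N) (g g' : R -> R) :
  (forall x, 0 <= x -> mxder F x (F' x)) ->
  (forall x : R, 0 <= x -> is_derive x (1 : R) g (g' x)) ->
  (forall x, 0 <= x -> nrm (F' x) <= g' x) ->
  forall x, 0 <= x ->
    nrm (F x) <= nrm (F 0) + N%:R * (N%:R * ((g x - g 0) + (g x - g 0))).
Proof.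
move=> dF dg Fg x x0; rewrite -[F x](subrK (F 0)) [leRHS]addrC.
apply: le_trans (nrmD _ _) _; rewrite lerD2r; apply: nrm_le_ReIm => i j.
rewrite !mxE !raddfB.
have b y : 0 <= y -> normc (F' y i j) <= g' y.
  by move=> y0; apply: le_trans (normc_le_nrm _ _ _) (Fg y y0).
split.
  apply: (@derive_le_incr _ (fun t => complex.Re (F t i j)) (fun t => complex.Re (F' t i j)) g g') => // y y0.
    by have [] := dF y y0 i j.
  exact: le_trans (Re_le_normc _) (b y y0).
apply: (@derive_le_incr _ (fun t => complex.Im (F t i j)) (fun t => complex.Im (F' t i j)) g g') => // y y0.
  by have [] := dF y y0 i j.
exact: le_trans (Im_le_normc _) (b y y0).
Qed.

(** Induction on the list of roots. For [W = V (P - l)] the bound is known, and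
    [exp (l x) V exp (- x P)] has derivative [- exp (l x) W exp (- x P)], of size
    [exp ((Re l - a) x)]; integrating and dividing by [exp (l x)] gives the bound
    for [V]. *)
Lemma decay_roots P a (rs : seq R[i]) :
  (forall l, l \in rs -> a < complex.Re l) ->
  forall V, V *m \prod_(l <- rs) (P - l%:M) = 0 ->
  exists2 K, 0 <= K &
    forall x, 0 <= x -> nrm (V *m mxexp (x%:C *: - P)) <= K * expR (- a * x).
Proof.
elim: rs => [_ V|l rs ih ars V].
  rewrite big_nil -[1]/(1%:M) mulmx1 => ->; exists 0 => // x _.
  by rewrite mul0mx nrm0 mul0r.
rewrite big_cons -[_ * _]/(_ *m _) mulmxA => /ih[|K K0 hK].
  by move=> l' l'rs; apply: ars; rewrite inE l'rs orbT.
have d0 : 0 < complex.Re l - a by rewrite subr_gt0 ars ?mem_head.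
set d := complex.Re l - a in d0.
pose c : R := N%:R * (N%:R * 2) * (K / d).
exists (nrm V + c).
  by rewrite addr_ge0 ?nrm_ge0// mulr_ge0 ?divr_ge0// ltW.
move=> x x0.
pose F t := cexp (t%:C * l) *: (V *m mxexp (t%:C *: - P)).
pose F' t := - (cexp (t%:C * l) *: (V *m (P - l%:M) *m mxexp (t%:C *: - P))).
pose g (t : R) : R := K / d * expR (t * d).
have FF' (t : R) : 0 <= t -> mxder F t (F' t).
  move=> _; apply: mxder_eq (mxderZ (cder_cexp l t) (mxder_exp V (- P) t)) _.
  rewrite /F'; move: (mxexp _) => E.
  rewrite mulmxBr mulmxBl mul_mx_scalar scalerBr opprB mulmxN mulNmx scalerN.
  by rewrite -scalemxAl scalerA [l * _]mulrC.
have gg' (t : R) : 0 <= t -> is_derive t (1 : R) g (K * expR (t * d)).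
  move=> _; apply: is_derive_eq; rewrite /GRing.scale /=.
  by field; rewrite gt_eqF.
have F'g (t : R) : 0 <= t -> nrm (F' t) <= K * expR (t * d).
  move=> t0; rewrite nrmN nrmZ normc_cexp Re_mul /= mul0r subr0.
  apply: le_trans (ler_wpM2l (expR_ge0 _) (hK t t0)) _.
  by rewrite mulrCA -expRD ler_wpM2l// ler_expR /d; lra.
have F0 : nrm (F 0) = nrm V.
  rewrite /F (_ : (0 : R)%:C = 0)// mul0r cexp0 scale0r mxexp0.
  by rewrite scale1r mulmx1.
have Fx : nrm (F x) = expR (x * complex.Re l) * nrm (V *m mxexp (x%:C *: - P)).
  by rewrite nrmZ normc_cexp Re_mul /= mul0r subr0.
have := mxder_nrm_le FF' gg' F'g x0; clearbody F; rewrite F0 Fx.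
move=> h; rewrite -(ler_pM2l (expR_gt0 (x * complex.Re l))).
apply: le_trans h _.
rewrite [leRHS]mulrCA -expRD (_ : x * _ + _ = x * d); last by rewrite /d; lra.
rewrite mulrDl lerD//.
  by rewrite ler_peMr ?nrm_ge0// -expR0 ler_expR mulr_ge0// ltW.
rewrite /c /g mul0r expR0 mulr1 -!mulrA ler_wpM2l// ler_wpM2l//.
have : 0 <= K / d by rewrite divr_ge0// ltW.
by rewrite mulrA; move: (K / d) (expR _) => u v; lra.
Qed.

End Decay.

Section Decays.
Context {R : realType} {N : nat}.
Implicit Types (M P V : 'M[R[i]]_N) (a K x t : R).

(** Positive stability in a form that passes to sums of commuting matrices by a mere
    product of bounds. *)
Definition decays M := exists a K, [/\ 0 < a, 0 <= K &
  forall x, 0 <= x -> nrm (mxexp (x%:C *: - M)) <= K * expR (- a * x)].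

Lemma decaysD M V : comm_mx M V -> decays M -> decays V -> decays (M + V).
Proof.
move=> cMV [a [K [a0 K0 hK]]] [b [L [b0 L0 hL]]]; exists (a + b), (K * L).
split; [exact: addr_gt0 | exact: mulr_ge0 | move=> x x0].
rewrite opprD scalerDr mxexpD; last first.
  rewrite /comm_mx -!scalemxAl -!scalemxAr; congr (_ *: (_ *: _)).
  by rewrite !mulmxN !mulNmx !opprK.
apply: le_trans (nrmM _ _) _.
apply: le_trans (ler_pM (nrm_ge0 _) (nrm_ge0 _) (hK x x0) (hL x x0)) _.
by rewrite mulrACA -expRD -mulrDl opprD.
Qed.

(** A vector of the kernel of [M + k] is multiplied by [exp (k x)] under
    [exp (- x M)], which contradicts decay. *)
Lemma decays_unit M (k : nat) : decays M -> M + k%:R%:M \in unitmx.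
Proof.
move=> [a [K [a0 K0 hK]]].
set V := kermx (M + k%:R%:M).
have VM : V *m M = - (k%:R *: V).
  apply/eqP; rewrite -addr_eq0 -mul_mx_scalar -mulmxDr; apply/eqP.
  exact: mulmx_ker.
suff V0 : V = 0 by rewrite -row_free_unit -kermx_eq0 -/V V0.
(* At [x = K / a] the decay bound is [K exp (- K) < 1]. *)
have x0 : 0 <= K / a by rewrite divr_ge0// ltW.
have grow : V *m mxexp ((K / a)%:C *: - M) = cexp (k%:R * (K / a)%:C) *: V.
  pose F (t : R) := cexp (t%:C * (k%:R * (K / a)%:C)) *: V.
  have F0 : F 0 = V by rewrite /F (_ : (0 : R)%:C = 0)// mul0r cexp0 scale1r.
  have F1 : F 1 = cexp (k%:R * (K / a)%:C) *: V by rewrite /F mul1r.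
  rewrite -F1 -{1}F0; apply/esym/mxexp_ode => y _.
  apply: mxder_eq (mxderZ (cder_cexp _ y) (mxder_cst V y)) _.
  rewrite scaler0 addr0 /F -scalemxAl -scalemxAr mulmxN VM opprK !scalerA.
  by congr (_ *: _); ring.
have : nrm V <= nrm V * (K * expR (- K)).
  apply: (@le_trans _ _ (nrm (V *m mxexp ((K / a)%:C *: - M)))).
    rewrite grow nrmZ normc_cexp ler_peMl ?nrm_ge0// -expR0 ler_expR.
    by rewrite Re_mul /= mulr0 subr0 -(rmorph_nat (real_complex R)) /= mulr_ge0.
  apply: le_trans (nrmM _ _) _; rewrite ler_wpM2l ?nrm_ge0//.
  apply: le_trans (hK _ x0) _; rewrite ler_wpM2l// ler_expR.
  by rewrite mulNr mulrCA mulfV ?gt_eqF// mulr1.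
have K1 : K * expR (- K) < 1.
  rewrite expRN ltr_pdivrMr ?expR_gt0// mul1r.
  by apply: lt_le_trans (expR_ge1Dx K); rewrite ltrDr.
move=> h; apply: nrm_eq0; rewrite leNgt; apply/negP => V0.
by move: h; rewrite leNgt (gtr_pMr _ V0) K1.
Qed.

End Decays.

(** Cayley-Hamilton, with the characteristic polynomial split into linear factors. *)
Lemma positive_stable_decays {R : realType} {N : nat} (P : 'M[R[i]]_N) :
  positive_stable P -> decays P.
Proof.
case: N P => [|n] P sP.
  exists 1, 0; split=> // x _.
  by rewrite /nrm big_ord0 mul0r.
have [rs rsE] := closed_field_poly_normal (char_poly P).
rewrite (monicP (char_poly_monic P)) scale1r in rsE.
have rs_pos l : l \in rs -> 0 < complex.Re l.
  by move=> lrs; apply: sP; rewrite eigenvalue_root_char rsE root_prod_XsubC.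
have CH : 1%:M *m \prod_(l <- rs) (P - l%:M) = 0.
  rewrite mul1mx -(Cayley_Hamilton P) rsE rmorph_prod; apply: eq_bigr => l _.
  by rewrite rmorphB /= horner_mx_X horner_mx_C.
have [a a0 ars] : exists2 a : R, 0 < a & forall l, l \in rs -> a < complex.Re l.
  elim: (rs) rs_pos => [|l s ih] h; first by exists 1.
  have [|a a0 has] := ih; first by move=> m ms; apply: h; rewrite inE ms orbT.
  have l0 := h l (mem_head _ _).
  exists (Num.min a (complex.Re l / 2)); first by rewrite lt_min a0 divr_gt0.
  move=> m; rewrite inE => /predU1P[->|ms]; rewrite gt_min ?(has m ms)//.
  by apply/orP; right; rewrite ltr_pdivrMr// ltr_pMr// ltr1n.
have [K K0 hK] := decay_roots ars CH.
by exists a, K; split => // x x0; have := hK x x0; rewrite mul1mx.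
Qed.

(** * Real powers with matrix exponent *)

Section RealPower.
Context {R : realType} {N : nat}.
Implicit Types (M P V : 'M[R[i]]_N) (a K x t : R).

(** For [t > 0] this is [t^M]; written without the complex logarithm it can be
    differentiated in [t]. *)
Definition tpow t M := mxexp ((ln t)%:C *: M).

Lemma cln_real t : 0 < t -> cln t%:C = (ln t)%:C.
Proof.
move=> t0; rewrite /cln normc_real gtr0_norm// /carg normc_real gtr0_norm//.
rewrite [complex.Re _]/= [complex.Im _]/= lexx divff; last by rewrite gt_eqF.
by rewrite acos1.
Qed.

Lemma mxpow_real t M : 0 < t -> mxpow t%:C M = tpow t M.
Proof. by move=> t0; rewrite /mxpow cln_real. Qed.

Lemma mxder_tpow M x : 0 < x ->
  mxder (fun t => tpow t M) x ((x^-1)%:C *: (M *m tpow x M)).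
Proof.
move=> x0; apply: mxder_comp (mxder_exp1 M (ln x)) _.
exact: is_derive1_ln.
Qed.

Lemma comm_tpow M V t : comm_mx M V -> comm_mx M (tpow t V).
Proof.
by move=> cMV; apply: mxexp_comm; rewrite /comm_mx -scalemxAl -scalemxAr cMV.
Qed.

Lemma tpow_ge1 M : exists2 K, 0 <= K &
  forall t, 1 <= t -> nrm (tpow t M) <= K * expR (nrm M * ln t).
Proof.
exists (nrm (1%:M : 'M[R[i]]_N)) => [|t t1]; first exact: nrm_ge0.
apply: le_trans (nrm_mxexp _) _; rewrite ler_wpM2l ?nrm_ge0//.
by rewrite nrmZ normc_real ger0_norm ?ln_ge0// mulrC.
Qed.

Lemma tpow_le1 P : decays P -> exists a K, [/\ 0 < a, 0 <= K &
  forall t, 0 < t <= 1 -> nrm (tpow t (P - 1%:M)) <= K * expR ((a - 1) * ln t)].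
Proof.
move=> [a [K [a0 K0 hK]]]; exists a, K; split => // t /andP[t0 t1].
rewrite /tpow.
have -> : (ln t)%:C *: (P - 1%:M) = (- ln t)%:C *: - P + (- ln t)%:C%:M.
  have -> : (- ln t)%:C = - (ln t)%:C by rewrite rmorphN.
  by rewrite -[(- (ln t)%:C)%:M]scalemx1 scalerBr scalerN !scaleNr opprK.

rewrite mxexp_addscalar cexp_real nrmZ normc_real ger0_norm ?expR_ge0//.
have lt0 : 0 <= - ln t by rewrite oppr_ge0 ln_le0.
apply: le_trans (ler_wpM2l (expR_ge0 _) (hK _ lt0)) _.
by rewrite mulrCA ler_wpM2l// -expRD ler_expR; lra.
Qed.

End RealPower.

(** * Integrals over an exhausted set *)

Section RealIntegral.
Context {R : realType}.
Implicit Types (D : set R) (f g h : R -> R).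
Local Notation mu := (@lebesgue_measure R).

Lemma integrable_scale D c g : measurable D -> mu.-integrable D (EFin \o g) ->
  mu.-integrable D (EFin \o (fun t => c * g t)).
Proof.
move=> mD gi; rewrite (_ : _ \o _ = (fun t => c%:E * (g t)%:E)%E); first exact: integrableZl.
by apply/funext => t /=; rewrite EFinM.
Qed.

(** Closed intervals increasing to an open set. They let ]0, 1[ and ]0, +oo[ be
    treated together: what happens at an end point becomes a limit along [u] or
    [v], whether that end point is finite or not. *)
Record exhausts D (u v : nat -> R) : Prop := {
  exh_lt : forall n, u n < v n;
  exh_sub : forall n x, u n <= x <= v n -> D x;
  exh_ndec : forall n m, (n <= m)%N -> u m <= u n /\ v n <= v m;
  exh_cover : forall x, D x -> exists n, u n <= x <= v n;
  exh_open : open D }.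

Section Exhausted.
Context {D : set R} {u v : nat -> R}.
Hypothesis exh : exhausts D u v.

Lemma exh_measurable : measurable D.
Proof. by apply: open_measurable; case: exh. Qed.

Lemma exh_bigcup : \bigcup_n `[u n, v n]%classic = D.
Proof.
apply/seteqP; split=> [x [n _]|x Dx].
  by rewrite /= in_itv; exact: exh_sub.
by have [n xn] := exh_cover exh Dx; exists n => //=; rewrite in_itv.
Qed.

Lemma continuous_measurable f : (forall x, D x -> {for x, continuous f}) ->
  measurable_fun D f.
Proof.
move=> cf; apply: open_continuous_measurable_fun; first by case: exh.
by move=> x /set_mem; exact: cf.
Qed.

Lemma FTC_exh f h n : (forall x, D x -> is_derive x (1 : R) h (f x)) ->
  (forall x, D x -> {for x, continuous f}) ->
  (\int[mu]_(x in `[u n, v n]) (f x)%:E = (h (v n) - h (u n))%:E)%E.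
Proof.
move=> dh cf.
have sub x : u n <= x <= v n -> D x by exact: exh_sub.
have uv := exh_lt exh n; have [uv1 uv2] := (ltW uv, lexx (u n)).
rewrite (@continuous_FTC2 _ f h)//.
- apply: continuous_in_subspaceT => x /set_mem /=; rewrite in_itv /= => xn.
  exact/cf/sub.
- split=> [x||].
  + rewrite in_itv /= => /andP[ux xv]; have Dx : D x by apply: sub; rewrite !ltW.
    by case: (dh x Dx).
  + apply: cvg_at_right_filter; apply: is_derive_continuous (dh _ _).
    by apply: sub; rewrite lexx uv1.
  + apply: cvg_at_left_filter; apply: is_derive_continuous (dh _ _).
    by apply: sub; rewrite lexx uv1.
- move=> x; rewrite in_itv /= => /andP[ux xv].
  have Dx : D x by apply: sub; rewrite !ltW.
  by rewrite derive1E; case: (dh x Dx).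
Qed.

Lemma nd_itv : {homo (fun n => `[u n, v n]%classic) : n m / (n <= m)%N >-> (n <= m)%O}.
Proof.
move=> n m nm; have [um vm] := exh_ndec exh nm.
by apply/subsetPset => x /=; rewrite !in_itv /= => /andP[a b]; rewrite (le_trans um a) (le_trans b vm).
Qed.

Lemma cvg_integral_exh f : measurable_fun D f -> (forall x, D x -> 0 <= f x) ->
  (\int[mu]_(x in `[u n, v n]) (f x)%:E @[n --> \oo] --> \int[mu]_(x in D) (f x)%:E)%E.
Proof.
move=> mf f0; rewrite -exh_bigcup.
apply: ge0_nondecreasing_set_cvg_integral; first exact: nd_itv.
- by move=> n; exact: measurable_itv.
- move=> n; apply/measurable_EFinP; apply: measurable_funS mf.
    exact: exh_measurable.
  by move=> x /=; rewrite in_itv; exact: exh_sub.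
- by move=> n x /=; rewrite in_itv /= => xn; rewrite lee_fin; apply: f0; exact: (exh_sub exh xn).
Qed.

(** The integrals over the exhausting intervals are the increments of the
    antiderivative, hence bounded. *)
Lemma integrable_antiderivative g h C :
  (forall x, D x -> is_derive x (1 : R) h (g x)) ->
  (forall x, D x -> {for x, continuous g}) ->
  (forall x, D x -> 0 <= g x) -> (forall x, D x -> `|h x| <= C) ->
  mu.-integrable D (EFin \o g).
Proof.
move=> dh cg g0 hC; have mg := continuous_measurable cg.
apply/integrableP; split; first exact/measurable_EFinP.
rewrite (_ : (\int[mu]_(x in D) _)%E = (\int[mu]_(x in D) (g x)%:E)%E); last first.
  by apply: eq_integral => x /set_mem Dx /=; rewrite ger0_norm ?g0.
have cv := cvg_integral_exh mg g0.
rewrite -(cvg_lim _ cv)//; apply: (@le_lt_trans _ _ (C + C)%:E); last exact: ltry.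
apply: lime_le; first exact: cvgP cv.
apply: nearW => n; rewrite (FTC_exh _ dh cg) lee_fin.
have uv := ltW (exh_lt exh n).
have b x : u n <= x <= v n -> `|h x| <= C by move=> /(exh_sub exh); exact: hC.
apply: le_trans (ler_norm _) _; apply: le_trans (ler_normB _ _) _.
by rewrite lerD ?b// lexx uv.
Qed.

(** Fundamental theorem of calculus for an absolutely integrable derivative, whose
    positive and negative parts are treated by monotone convergence. *)
Lemma integral_derivative0 f h :
  (forall x, D x -> is_derive x (1 : R) h (f x)) ->
  (forall x, D x -> {for x, continuous f}) ->
  mu.-integrable D (EFin \o f) ->
  h (u n) @[n --> \oo] --> (0 : R) -> h (v n) @[n --> \oo] --> (0 : R) ->
  \int[mu]_(x in D) f x = 0.
Proof.
move=> dh cf fi hu hv; have mD := exh_measurable.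
have mf : measurable_fun D f by exact: continuous_measurable.
have pos : (\int[mu]_(x in `[u n, v n]) (Num.max (f x) 0)%:E @[n --> \oo] -->
    \int[mu]_(x in D) (Num.max (f x) 0)%:E)%E.
  apply: cvg_integral_exh => [|x _]; last by rewrite le_max lexx orbT.
  exact: measurable_maxr.
have neg : (\int[mu]_(x in `[u n, v n]) (Num.max (- f x) 0)%:E @[n --> \oo] -->
    \int[mu]_(x in D) (Num.max (- f x) 0)%:E)%E.
  apply: cvg_integral_exh => [|x _]; last by rewrite le_max lexx orbT.
  by apply: measurable_maxr => //; exact: measurableT_comp.
have E (A : set R) : (\int[mu]_(x in A) (f x)%:E =
    \int[mu]_(x in A) (Num.max (f x) 0)%:E - \int[mu]_(x in A) (Num.max (- f x) 0)%:E)%E.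
  rewrite integralE; congr (_ - _)%E; apply: eq_integral => x _.
    by rewrite funeposE EFin_max.
  by rewrite funenegE EFin_max.
have posfin : (\int[mu]_(x in D) (Num.max (f x) 0)%:E)%E \is a fin_num.
  rewrite (_ : integral _ _ _ = (\int[mu]_(x in D) (EFin \o f)^\+ x)%E).
    exact: integrable_pos_fin_num.
  by apply: eq_integral => x _; rewrite funeposE EFin_max.
have cv : (\int[mu]_(x in `[u n, v n]) (f x)%:E @[n --> \oo] --> \int[mu]_(x in D) (f x)%:E)%E.
  rewrite E; under eq_fun do rewrite E.
  by apply: cvgeB => //; rewrite fin_num_adde_defr.
have : (\int[mu]_(x in `[u n, v n]) (f x)%:E @[n --> \oo] --> 0%:E)%E.
  under eq_fun do rewrite (FTC_exh _ dh cf).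
  apply: cvg_EFin; first by apply: nearW.
  by rewrite -[X in _ --> X](subr0 0); exact: cvgB.
by move=> /(cvg_unique _ cv) => /(_ (@ereal_hausdorff R)) cv0; rewrite /Rintegral cv0.
Qed.

End Exhausted.

(** The shift by 3 keeps the first interval nondegenerate. *)
Lemma exhausts01 : exhausts `]0 : R, 1[ (fun n => n.+3%:R^-1) (fun n => 1 - n.+3%:R^-1).
Proof.
have h n : 0 < n.+3%:R^-1 :> R by rewrite invr_gt0.
have h2 n : n.+3%:R^-1 <= 3^-1 :> R by rewrite lef_pV2 ?posrE// ler_nat.
split=> [n|n x /andP[a b]|n m nm|x|].
- by have := h2 n; move: (_^-1) => /= y hy; lra.
- have := h n; rewrite /= in_itv /=; move: (_^-1) a b => y a b y0.
  by apply/andP; split; lra.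
- have : m.+3%:R^-1 <= n.+3%:R^-1 :> R by rewrite lef_pV2 ?posrE// ler_nat.
  by move: (m.+3%:R^-1) (n.+3%:R^-1) => y z yz; split; lra.
- rewrite /= in_itv /= => /andP[x0 x1].
  have e0 : 0 < Num.min x (1 - x) by rewrite lt_min x0 subr_gt0.
  have [n hn] : exists n, (n.+3%:R)^-1 < Num.min x (1 - x).
    exists (Num.truncn (Num.min x (1 - x))^-1).
    rewrite invf_plt ?posrE//; apply: lt_le_trans (truncnS_gt _) _.
    by rewrite ler_nat !ltnS -addn2 leq_addr.
  move: hn; rewrite lt_min => /andP[h1 h3]; exists n.
  by move: (_^-1) h1 h3 => y h1 h3; apply/andP; split; lra.
- exact: interval_open.
Qed.

Lemma exhausts0y : exhausts `]0 : R, +oo[ (fun n => n.+2%:R^-1) (fun n => n.+2%:R).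
Proof.
have h n : 0 < n.+2%:R^-1 :> R by rewrite invr_gt0.
split=> [n|n x /andP[a b]|n m nm|x|].
- by apply: (@lt_trans _ _ 1); rewrite ?invf_lt1 ?ltr1n.
- by rewrite /= in_itv /= andbT; apply: lt_le_trans a.
- by rewrite lef_pV2 ?posrE// !ler_nat.
- rewrite /= in_itv /= andbT => x0; have ix0 : 0 < x^-1 by rewrite invr_gt0.
  exists (Num.truncn x^-1 + Num.truncn x)%N; apply/andP; split.
    rewrite invf_ple ?posrE//; apply: le_trans (ltW (truncnS_gt _)) _.
    by rewrite ler_nat ltnS leqW// leq_addr.
  apply: le_trans (ltW (truncnS_gt _)) _.
  by rewrite ler_nat ltnS leqW// leq_addl.
- exact: interval_open.
Qed.

End RealIntegral.

(** * Integrals of complex and matrix functions *)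

Section ComplexIntegral.
Context {R : realType}.
Implicit Types (D : set R) (f g : R -> R[i]).
Local Notation mu := (@lebesgue_measure R).

Definition cintegrable D f :=
  mu.-integrable D (fun t => (complex.Re (f t))%:E) /\
  mu.-integrable D (fun t => (complex.Im (f t))%:E).

Definition cintegral D f : R[i] :=
  (\int[mu]_(t in D) complex.Re (f t)) +i* (\int[mu]_(t in D) complex.Im (f t)).

Lemma cintegrable_ext D f g : measurable D -> (forall t, D t -> f t = g t) ->
  cintegrable D f -> cintegrable D g.
Proof.
by move=> mD fg [f1 f2]; split; [apply: eq_integrable f1|apply: eq_integrable f2] => //;
  move=> t /set_mem Dt /=; rewrite fg.
Qed.

Lemma cintegral_ext D f g : (forall t, D t -> f t = g t) ->
  cintegral D f = cintegral D g.
Proof.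
by move=> fg; congr (_ +i* _); apply: eq_Rintegral => t /set_mem Dt; rewrite fg.
Qed.

Lemma cintegrable0 D : cintegrable D (fun=> 0).
Proof. by split; exact: integrable0. Qed.

Lemma cintegral0 D : cintegral D (fun=> 0) = 0.
Proof. by rewrite /cintegral /Rintegral /= integral0. Qed.

Lemma cintegrableD D f g : measurable D -> cintegrable D f -> cintegrable D g ->
  cintegrable D (fun t => f t + g t).
Proof.
move=> mD [f1 f2] [g1 g2]; split.
  under eq_fun do rewrite Re_add EFinD; exact: integrableD.
under eq_fun do rewrite Im_add EFinD; exact: integrableD.
Qed.

Lemma cintegralD D f g : measurable D -> cintegrable D f -> cintegrable D g ->
  cintegral D (fun t => f t + g t) = cintegral D f + cintegral D g.
Proof.
move=> mD [f1 f2] [g1 g2]; rewrite /cintegral; simpc; congr (_ +i* _).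
  by under eq_fun do rewrite Re_add; rewrite RintegralD.
by under eq_fun do rewrite Im_add; rewrite RintegralD.
Qed.

Lemma cintegrableMr D f (c : R[i]) : measurable D -> cintegrable D f ->
  cintegrable D (fun t => f t * c).
Proof.
move=> mD [f1 f2]; split.
  under eq_fun do rewrite Re_mul [X in X - _]mulrC [X in _ - X]mulrC EFinB !EFinM.
  by apply: integrableB => //; apply: integrableZl.
under eq_fun do rewrite Im_mul [X in X + _]mulrC [X in _ + X]mulrC EFinD !EFinM.
by apply: integrableD => //; apply: integrableZl.
Qed.

Lemma cintegralMr D f (c : R[i]) : measurable D -> cintegrable D f ->
  cintegral D (fun t => f t * c) = cintegral D f * c.
Proof.
move=> mD [f1 f2].
have iZ (h : R -> R) r : mu.-integrable D (EFin \o h) ->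
    mu.-integrable D (EFin \o (fun t => r * h t)) by exact: integrable_scale.
case: c => a b; rewrite /cintegral; simpc; congr (_ +i* _).
  under eq_fun do rewrite Re_mul /= [X in X - _]mulrC [X in _ - X]mulrC.
  rewrite RintegralB//; [|exact: iZ|exact: iZ].
  by rewrite !RintegralZl// [X in X - _]mulrC [X in _ - X]mulrC.
under eq_fun do rewrite Im_mul /= [X in X + _]mulrC [X in _ + X]mulrC.
rewrite RintegralD//; [|exact: iZ|exact: iZ].
by rewrite !RintegralZl// [X in X + _]mulrC [X in _ + X]mulrC.
Qed.

Lemma cintegrable_sum D I (r : seq I) (f : I -> R -> R[i]) : measurable D ->
  (forall i, cintegrable D (f i)) ->
  cintegrable D (fun t => \sum_(i <- r) f i t) /\
  cintegral D (fun t => \sum_(i <- r) f i t) = \sum_(i <- r) cintegral D (f i).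
Proof.
move=> mD fi; elim: r => [|i r [ih1 ih2]].
  under eq_fun do rewrite big_nil; rewrite big_nil.
  by split; [exact: cintegrable0|exact: cintegral0].
under eq_fun do rewrite big_cons; rewrite big_cons.
by split; [exact: cintegrableD|rewrite cintegralD// ih2].
Qed.

End ComplexIntegral.

Section MatrixIntegral.
Context {R : realType} {N : nat}.
Implicit Types (D : set R) (F G H : R -> 'M[R[i]]_N) (M : 'M[R[i]]_N).
Local Notation mu := (@lebesgue_measure R).

Lemma mxintegralE D F i j : mxintegral D F i j = cintegral D (fun t => F t i j).
Proof. by rewrite mxE. Qed.

Lemma mxintegrable_ext D F G : measurable D -> (forall t, D t -> F t = G t) ->
  mxintegrable D F -> mxintegrable D G.
Proof.
move=> mD FG Fi i j; apply: cintegrable_ext (Fi i j) => // t Dt.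
by rewrite FG.
Qed.

Lemma mxintegral_ext D F G : (forall t, D t -> F t = G t) ->
  mxintegral D F = mxintegral D G.
Proof.
move=> FG; apply/matrixP => i j; rewrite !mxintegralE.
by apply: cintegral_ext => t Dt; rewrite FG.
Qed.

Lemma mxintegrableMr D F M : measurable D -> mxintegrable D F ->
  mxintegrable D (fun t => F t *m M).
Proof.
move=> mD Fi i j; have [h _] := cintegrable_sum (index_enum 'I_N) mD
  (fun k => cintegrableMr (M k j) mD (Fi i k)).
by apply: cintegrable_ext h => // t _; rewrite mxE.
Qed.

Lemma mxintegralMr D F M : measurable D -> mxintegrable D F ->
  mxintegral D (fun t => F t *m M) = mxintegral D F *m M.
Proof.
move=> mD Fi; apply/matrixP => i j; have [_ h] := cintegrable_sum (index_enum 'I_N) mD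
  (fun k => cintegrableMr (M k j) mD (Fi i k)).
rewrite mxintegralE mxE (cintegral_ext (g := fun t => \sum_k F t i k * M k j)); last first.
  by move=> t _; rewrite mxE.
by rewrite h; apply: eq_bigr => k _; rewrite cintegralMr// mxintegralE.
Qed.

Lemma mxintegrable_sum D I (r : seq I) (F : I -> R -> 'M[R[i]]_N) : measurable D ->
  (forall i, mxintegrable D (F i)) ->
  mxintegrable D (fun t => \sum_(i <- r) F i t) /\
  mxintegral D (fun t => \sum_(i <- r) F i t) = \sum_(i <- r) mxintegral D (F i).
Proof.
move=> mD Fi; split=> [i j|].
  have [h _] := cintegrable_sum r mD (fun k => Fi k i j).
  by apply: cintegrable_ext h => // t _; rewrite summxE.
apply/matrixP => i j; have [_ h] := cintegrable_sum r mD (fun k => Fi k i j).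
rewrite mxintegralE summxE (cintegral_ext (g := fun t => \sum_(k <- r) F k t i j)).
  by rewrite h; apply: eq_bigr => k _; rewrite mxintegralE.
by move=> t _; rewrite summxE.
Qed.

Definition mxmeasurable D F := forall i j,
  measurable_fun D (fun t => complex.Re (F t i j)) /\
  measurable_fun D (fun t => complex.Im (F t i j)).

Lemma mxder_continuous F x M i j : mxder F x M ->
  {for x, continuous (fun t => complex.Re (F t i j))} /\
  {for x, continuous (fun t => complex.Im (F t i j))}.
Proof.
by move=> /(_ i j)[h1 h2]; split;
  [exact: is_derive_continuous h1|exact: is_derive_continuous h2].
Qed.

Lemma mxder_measurable D u v F : exhausts D u v ->
  (forall x, D x -> exists M, mxder F x M) -> mxmeasurable D F.
Proof.
move=> exh dF i j; split; apply: (continuous_measurable exh) => x Dx;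
  by have [M /(mxder_continuous i j)[]] := dF x Dx.
Qed.

Lemma mxmeasurable_cvg D (F : nat -> R -> 'M[R[i]]_N) G :
  (forall n, mxmeasurable D (F n)) ->
  (forall t, D t -> mxcvg (F ^~ t) (G t)) -> mxmeasurable D G.
Proof.
move=> mF FG i j; split.
  apply: (@measurable_fun_cvg _ _ _ _ (fun n t => complex.Re (F n t i j))) => [n|t Dt].
    by case: (mF n i j).
  exact: mxcvg_Re (FG t Dt).
apply: (@measurable_fun_cvg _ _ _ _ (fun n t => complex.Im (F n t i j))) => [n|t Dt].
  by case: (mF n i j).
exact: mxcvg_Im (FG t Dt).
Qed.

Lemma mxintegrable_dom D F (g : R -> R) : measurable D -> mxmeasurable D F ->
  mu.-integrable D (EFin \o g) -> (forall t, D t -> nrm (F t) <= g t) ->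
  mxintegrable D F.
Proof.
move=> mD mF gi Fg i j; have [m1 m2] := mF i j.
split; apply: le_integrable gi => //; try exact/measurable_EFinP.
  move=> t Dt /=; rewrite lee_fin; apply: le_trans (Re_le_normc _) _.
  by apply: le_trans (normc_le_nrm _ _ _) _; apply: le_trans (Fg t Dt) (ler_norm _).
move=> t Dt /=; rewrite lee_fin; apply: le_trans (Im_le_normc _) _.
by apply: le_trans (normc_le_nrm _ _ _) _; apply: le_trans (Fg t Dt) (ler_norm _).
Qed.

Lemma Rintegral_dct D (f : nat -> R -> R) (f0 g : R -> R) : measurable D ->
  (forall n, measurable_fun D (f n)) ->
  (forall t, D t -> f n t @[n --> \oo] --> f0 t) ->
  mu.-integrable D (EFin \o g) -> (forall n t, D t -> `|f n t| <= g t) ->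
  mu.-integrable D (EFin \o f0) ->
  \int[mu]_(t in D) f n t @[n --> \oo] --> \int[mu]_(t in D) f0 t.
Proof.
move=> mD mf ff gi fg f0i.
have h1 n : measurable_fun D (EFin \o f n) by exact/measurable_EFinP.
have h2 t : D t -> ((EFin \o f n) t @[n --> \oo] --> (EFin \o f0) t)%E.
  by move=> Dt; apply: cvg_EFin; [by apply: nearW|exact: ff].
have h3 t : D t -> ((EFin \o g) t \is a fin_num)%E by [].
have h4 n t : D t -> (`|(EFin \o f n) t| <= (EFin \o g) t)%E.
  by move=> Dt /=; rewrite lee_fin fg.
have := @dominated_cvg _ _ _ mu D mD _ _ _ h1 h2 h3 gi h4.
rewrite -[X in (_ --> X)%E -> _]fineK; last exact: integrable_fin_num.
exact: fine_cvg.
Qed.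

Lemma mxintegral_dct D (F : nat -> R -> 'M[R[i]]_N) G (g : R -> R) : measurable D ->
  (forall n, mxmeasurable D (F n)) ->
  (forall t, D t -> mxcvg (F ^~ t) (G t)) ->
  mu.-integrable D (EFin \o g) ->
  (forall n t, D t -> nrm (F n t) <= g t) ->
  mxintegrable D G /\ mxcvg (fun n => mxintegral D (F n)) (mxintegral D G).
Proof.
move=> mD mF FG gi Fg.
have Gi : mxintegrable D G.
  apply: (mxintegrable_dom mD (mxmeasurable_cvg mF FG) gi) => t Dt.
  by apply: mxcvg_nrm_le (FG t Dt) _ => n; exact: Fg.
split=> //; apply: mxcvgP => i j; have [Gi1 Gi2] := Gi i j.
rewrite mxintegralE; split; under eq_fun do rewrite mxintegralE;
  apply: (Rintegral_dct (g := g)) => //.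
- by move=> n; case: (mF n i j).
- by move=> t Dt; exact: mxcvg_Re (FG t Dt).
- move=> n t Dt; apply: le_trans (Re_le_normc _) _.
  by apply: le_trans (normc_le_nrm _ _ _) (Fg n t Dt).
- by move=> n; case: (mF n i j).
- by move=> t Dt; exact: mxcvg_Im (FG t Dt).
- move=> n t Dt; apply: le_trans (Im_le_normc _) _.
  by apply: le_trans (normc_le_nrm _ _ _) (Fg n t Dt).
Qed.

Lemma mxintegral_derivative0 D u v F H : exhausts D u v ->
  (forall x, D x -> mxder H x (F x)) ->
  (forall x, D x -> exists M, mxder F x M) ->
  mxintegrable D F -> mxcvg (H \o u) 0 -> mxcvg (H \o v) 0 -> mxintegral D F = 0.
Proof.
move=> exh dH dF Fi Hu Hv; apply/matrixP => i j; rewrite mxintegralE mxE.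
have [Fi1 Fi2] := Fi i j; apply/eqP; rewrite eq_complex /=; apply/andP; split; apply/eqP.
  apply: (integral_derivative0 exh (h := fun t => complex.Re (H t i j))) => //.
  - by move=> x Dx; case: (dH x Dx i j).
  - by move=> x Dx; have [M /(mxder_continuous i j)[]] := dF x Dx.
  - by have := @mxcvg_Re _ _ _ _ i j Hu; rewrite mxE.
  - by have := @mxcvg_Re _ _ _ _ i j Hv; rewrite mxE.
apply: (integral_derivative0 exh (h := fun t => complex.Im (H t i j))) => //.
- by move=> x Dx; case: (dH x Dx i j).
- by move=> x Dx; have [M /(mxder_continuous i j)[]] := dF x Dx.
- by have := @mxcvg_Im _ _ _ _ i j Hu; rewrite mxE.
- by have := @mxcvg_Im _ _ _ _ i j Hv; rewrite mxE.
Qed.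

End MatrixIntegral.

(** * Integrable majorants *)

Section Majorants.
Context {R : realType}.
Implicit Types (a b c d t : R).
Local Notation mu := (@lebesgue_measure R).

(** The integrand is the derivative of [- exp (- t^a) / a], which is bounded on the
    whole half-line for every [a > 0], and it behaves like [t^(a - 1)] at 0. *)
Lemma integrable_powexp a : 0 < a -> mu.-integrable `]0, +oo[
  (EFin \o (fun t => expR ((a - 1) * ln t) * expR (- expR (a * ln t)))).
Proof.
move=> a0.
apply: (@integrable_antiderivative _ _ _ _ exhausts0y
  (fun t => expR ((a - 1) * ln t) * expR (- expR (a * ln t)))
  (fun t => - a^-1 * expR (- expR (a * ln t))) a^-1) => t;
  rewrite /= in_itv /= andbT => t0; try have dln := is_derive1_ln t0.
- apply: is_derive_eq; rewrite /GRing.scale /=.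
  rewrite mulrBl mul1r expRB lnK ?posrE//; field.
  by rewrite !gt_eqF.
- apply: is_derive_continuous; apply: is_derive_eq; reflexivity.
- by rewrite mulr_ge0 ?expR_ge0.
- rewrite normrM normrN !ger0_norm ?invr_ge0 ?expR_ge0 1?ltW//.
  rewrite gtr_pMr ?invr_gt0// expR_lt1.
  by rewrite oppr_lt0 expR_gt0.
Qed.

Lemma integrable_expN d : 0 < d ->
  mu.-integrable `]0, +oo[ (EFin \o (fun t => expR (- d * t))).
Proof.
move=> d0.
apply: (@integrable_antiderivative _ _ _ _ exhausts0y
  (fun t => expR (- d * t))
  (fun t => - d^-1 * expR (- d * t)) d^-1) => t;
  rewrite /= in_itv /= andbT => t0.
- apply: is_derive_eq; rewrite /GRing.scale /=; field.
  by rewrite gt_eqF.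
- apply: is_derive_continuous; apply: is_derive_eq; reflexivity.
- exact: expR_ge0.
- rewrite normrM normrN !ger0_norm ?invr_ge0 ?expR_ge0 1?ltW//.
  rewrite gtr_pMr ?invr_gt0// expR_lt1.
  by rewrite mulNr oppr_lt0 mulr_gt0.
Qed.

Lemma integrable_pow0 a : 0 < a -> mu.-integrable `]0, 1[
  (EFin \o (fun t => expR ((a - 1) * ln t))).
Proof.
move=> a0.
apply: (@integrable_antiderivative _ _ _ _ exhausts01
  (fun t => expR ((a - 1) * ln t))
  (fun t => a^-1 * expR (a * ln t)) a^-1) => t;
  rewrite /= in_itv /= => /andP[t0 t1]; try have dln := is_derive1_ln t0.
- apply: is_derive_eq; rewrite /GRing.scale /=.
  rewrite mulrBl mul1r expRB lnK ?posrE//; field.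
  by rewrite !gt_eqF.
- apply: is_derive_continuous; apply: is_derive_eq; reflexivity.
- exact: expR_ge0.
- rewrite normrM !ger0_norm ?invr_ge0 ?expR_ge0 1?ltW//.
  rewrite gtr_pMr ?invr_gt0// expR_lt1.
  by rewrite pmulr_rlt0// ln_lt0// t0.
Qed.

Lemma integrable_pow1 a : 0 < a -> mu.-integrable `]0, 1[
  (EFin \o (fun t => expR ((a - 1) * ln (1 - t)))).
Proof.
move=> a0.
apply: (@integrable_antiderivative _ _ _ _ exhausts01
  (fun t => expR ((a - 1) * ln (1 - t)))
  (fun t => - a^-1 * expR (a * ln (1 - t))) a^-1) => t;
  rewrite /= in_itv /= => /andP[t0 t1];
  have t1' : 0 < 1 - t by rewrite subr_gt0.
- have dln := is_derive1_ln t1'.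
  have d1 : is_derive t (1 : R) (fun t => ln (1 - t)) ((1 - t)^-1 * (0 - 1)).
    exact: (@is_derive1_comp _ _ (fun t => 1 - t)).
  apply: is_derive_eq; rewrite /GRing.scale /=.
  rewrite mulrBl mul1r expRB lnK ?posrE//; field.
  by rewrite !gt_eqF.
- have dln := is_derive1_ln t1'.
  have d1 : is_derive t (1 : R) (fun t => ln (1 - t)) ((1 - t)^-1 * (0 - 1)).
    exact: (@is_derive1_comp _ _ (fun t => 1 - t)).
  apply: is_derive_continuous; apply: is_derive_eq; reflexivity.
- exact: expR_ge0.
- rewrite normrM normrN !ger0_norm ?invr_ge0 ?expR_ge0 1?ltW//.
  rewrite gtr_pMr ?invr_gt0// expR_lt1.
  by rewrite pmulr_rlt0//; apply: ln_lt0; rewrite t1' gtrBl.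
Qed.

Lemma ln_le_subr1 t : 0 < t -> ln t <= t - 1.
Proof. by move=> t0; have := expR_ge1Dx (ln t); rewrite lnK ?posrE//; lra. Qed.

Lemma pow_le_exp (m d : R) : 0 <= m -> 0 < d ->
  exists2 C, 0 <= C & forall t, 0 < t -> expR (m * ln t) <= C * expR (d * t).
Proof.
move=> m0 d0.
(* The scale at which [ln (e t) <= e t - 1] is used; [m e <= d]. *)
pose e := d / (m + 1); have m1 : 0 < m + 1 by lra.
have e0 : 0 < e by rewrite divr_gt0.
have me : m * e <= d.
  by rewrite /e mulrA ler_pdivrMr// mulrC ler_wpM2l ?(ltW d0)//; lra.
exists (expR (- (m * ln e))) => [|t t0]; first exact: expR_ge0.
rewrite -expRD ler_expR.
have := ln_le_subr1 (mulr_gt0 e0 t0); rewrite lnM ?posrE// => h.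
have h2 := ler_wpM2l m0 h.
have h3 : m * e * t <= d * t by rewrite ler_wpM2r// ltW.
by move: h2 h3; rewrite mulrDr mulrBr mulrA; lra.
Qed.

Lemma pow_half_le a t : 2^-1 <= t <= 1 ->
  expR ((a - 1) * ln t) <= expR (`|a - 1| * ln 2).
Proof.
move=> /andP[t2 t1]; have t0 : 0 < t by apply: lt_le_trans t2.
rewrite ler_expR; apply: le_trans (ler_norm _) _; rewrite normrM ler_wpM2l//.
by rewrite ler0_norm ?ln_le0// -lnV ?posrE// ler_ln ?posrE// ?invr_gt0// invf_ple ?posrE.
Qed.

(** On ]0, 1] the singularity of [t^(P - 1)] is that of [t^(a - 1)] with [a > 0];
    on [1, +oo[ its polynomial growth is absorbed by half of the exponential. *)
Lemma laplace_majorant {N : nat} (P : 'M[R[i]]_N) c : decays P -> 0 < c ->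
  exists g : R -> R, [/\ forall t, 0 <= g t, mu.-integrable `]0, +oo[ (EFin \o g) &
    forall t, 0 < t -> expR (- c * t) * nrm (tpow t (P - 1%:M)) <= g t].
Proof.
move=> /tpow_le1[a [K [a0 K0 hK]]] c0.
have [L L0 hL] := tpow_ge1 (P - 1%:M).
have c20 : 0 < c / 2 by rewrite divr_gt0.
have [C C0 hC] := pow_le_exp (nrm_ge0 (P - 1%:M)) c20.
pose p t := expR ((a - 1) * ln t) * expR (- expR (a * ln t)).
pose q t := expR (- (c / 2) * t).
have p0 t : 0 <= p t by rewrite mulr_ge0 ?expR_ge0.
have q0 t : 0 <= q t by rewrite expR_ge0.
exists (fun t => (K * expR 1) * p t + (L * C) * q t).
have k1 : 0 <= K * expR 1 by rewrite mulr_ge0 ?expR_ge0.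
have k2 : 0 <= L * C by rewrite mulr_ge0.
split=> [t||t t0]; first by rewrite addr_ge0 ?mulr_ge0.
  have m0y : measurable (`]0 : R, +oo[ : set R) by exact: measurable_itv.
  exact: integrableD (integrable_scale (K * expR 1) m0y (integrable_powexp a0))
    (integrable_scale (L * C) m0y (integrable_expN c20)).
have [t1|t1] := leP t 1.
  apply: (@le_trans _ _ ((K * expR 1) * p t)); last by rewrite lerDl mulr_ge0.
  apply: (@le_trans _ _ (nrm (tpow t (P - 1%:M)))).
    rewrite ler_piMl ?nrm_ge0// -expR0 ler_expR mulNr oppr_le0.
    by rewrite mulr_ge0 ?ltW.
  apply: le_trans (hK t _) _; first by rewrite t0 t1.
  rewrite -mulrA ler_wpM2l// /p mulrCA ler_peMr ?expR_ge0//.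
  rewrite -expRD -expR0 ler_expR subr_ge0 ler_expR.
  by rewrite mulr_ge0_le0 ?(ltW a0)// ln_le0.
apply: (@le_trans _ _ ((L * C) * q t)); last by rewrite lerDr mulr_ge0.
apply: le_trans (ler_wpM2l (expR_ge0 _) (hL t (ltW t1))) _.
rewrite mulrCA -mulrA ler_wpM2l//.
apply: le_trans (ler_wpM2l (expR_ge0 _) (hC t t0)) _.
rewrite mulrCA ler_wpM2l// -expRD ler_expR; lra.
Qed.

(** Only one of the two factors is singular at each end point; on the other half of
    the interval it is bounded. *)
Lemma beta_majorant {N : nat} (P Q : 'M[R[i]]_N) : decays P -> decays Q ->
  exists2 g : R -> R, mu.-integrable `]0, 1[ (EFin \o g) &
    forall t, 0 < t < 1 ->
      nrm (tpow t (P - 1%:M)) * nrm (tpow (1 - t) (Q - 1%:M)) <= g t.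
Proof.
move=> /tpow_le1[a [K [a0 K0 hK]]] /tpow_le1[b [L [b0 L0 hL]]].
pose p t := expR ((a - 1) * ln t); pose q t := expR ((b - 1) * ln (1 - t)).
pose k1 := (K * L) * expR (`|b - 1| * ln 2).
pose k2 := (K * L) * expR (`|a - 1| * ln 2).
have k10 : 0 <= k1 by rewrite !mulr_ge0 ?expR_ge0.
have k20 : 0 <= k2 by rewrite !mulr_ge0 ?expR_ge0.
exists (fun t => k1 * p t + k2 * q t).
  have m01 : measurable (`]0 : R, 1[ : set R) by exact: measurable_itv.
  exact: integrableD (integrable_scale k1 m01 (integrable_pow0 a0))
    (integrable_scale k2 m01 (integrable_pow1 b0)).
move=> t /andP[t0 t1].
have t01 : 0 < t <= 1 by rewrite t0 ltW.
have t01' : 0 < 1 - t <= 1 by rewrite subr_gt0 t1 gerBl ltW.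
apply: le_trans (ler_pM (nrm_ge0 _) (nrm_ge0 _) (hK t t01) (hL _ t01')) _.
rewrite mulrACA -/(p t) -/(q t).
have p0 : 0 <= p t := expR_ge0 _; have q0 : 0 <= q t := expR_ge0 _.
have KL : 0 <= K * L by rewrite mulr_ge0.
have [t2|t2] := leP t 2^-1.
  apply: (@le_trans _ _ (k1 * p t)); last by rewrite lerDl mulr_ge0.
  rewrite /k1 -[leRHS]mulrA ler_wpM2l// mulrC ler_wpM2r// pow_half_le//.
  by apply/andP; split; lra.
apply: (@le_trans _ _ (k2 * q t)); last by rewrite lerDr mulr_ge0.
rewrite /k2 -[leRHS]mulrA ler_wpM2l// ler_wpM2r// pow_half_le//.
by rewrite ltW//= ltW.
Qed.

End Majorants.

(** * Pochhammer symbols and hypergeometric series *)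

Section Pochhammer.
Context {R : realType} {N : nat}.
Implicit Types (M B X : 'M[R[i]]_N) (As Bs : seq 'M[R[i]]_N) (z : R[i]).

Lemma mxpoch0 M : mxpoch M 0 = 1%:M.
Proof. by rewrite /mxpoch big_geq. Qed.

Lemma mxpochS M k : mxpoch M k.+1 = mxpoch M k *m (M + k%:R%:M).
Proof. by rewrite /mxpoch big_nat_recr. Qed.

Lemma mxpoch_unit M : (forall s : nat, M + s%:R%:M \in unitmx) ->
  forall k, mxpoch M k \in unitmx.
Proof.
move=> uM; elim=> [|k ih]; first by rewrite mxpoch0 unitmx1.
by rewrite mxpochS unitmx_mul ih uM.
Qed.

Lemma invmx_pochS M k : (forall s : nat, M + s%:R%:M \in unitmx) ->
  invmx (mxpoch M k.+1) = invmx (M + k%:R%:M) *m invmx (mxpoch M k).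
Proof.
move=> uM; set X := RHS.
have uk := mxpoch_unit uM k.
have h : mxpoch M k.+1 *m X = 1%:M.
  by rewrite mxpochS /X mulmxA mulmxK ?uM// mulmxV.
by rewrite -[LHS]mulmx1 -h mulKmx// mxpoch_unit.
Qed.

Lemma comm_mxV X M : comm_mx X M -> comm_mx X (invmx M).
Proof.
move=> cXM; have [uM|uM] := boolP (M \in unitmx); last first.
  by rewrite /invmx (negPf uM).
rewrite /comm_mx -[LHS]mul1mx -(mulVmx uM) -!mulmxA (mulmxA M) -cXM.
by rewrite -(mulmxA X) mulmxV// mulmx1.
Qed.

Lemma comm_poch X M k : comm_mx X M -> comm_mx X (mxpoch M k).
Proof.
move=> cXM; elim: k => [|k ih]; first by rewrite mxpoch0; exact: comm_mx1.
rewrite mxpochS; apply: comm_mxM => //; apply: comm_mxD => //.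
exact: comm_mx_scalar.
Qed.

Lemma nrm_addscalar M k : nrm (M + k%:R%:M) <= nrm M + nrm (1%:M : 'M[R[i]]_N) * k%:R.
Proof.
apply: le_trans (nrmD _ _) _; rewrite lerD2l -scalemx1 nrmZ normc_nat.
by rewrite mulrC.
Qed.

Lemma nrm_poch_le M : exists c K, [/\ 0 <= c, 0 <= K &
  forall k, nrm (mxpoch M k) <= K * c ^+ k * k`!%:R].
Proof.
have n1 := nrm_ge0 (1%:M : 'M[R[i]]_N); have nM := nrm_ge0 M.
exists (nrm M + nrm (1%:M : 'M[R[i]]_N)), (nrm (1%:M : 'M[R[i]]_N)).
split=> //; first exact: addr_ge0.
elim=> [|k ih]; first by rewrite mxpoch0 expr0 !mulr1.
rewrite mxpochS; apply: le_trans (nrmM _ _) _.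
apply: le_trans (ler_pM (nrm_ge0 _) (nrm_ge0 _) ih (nrm_addscalar _ _)) _.
set c := nrm M + _; rewrite exprSr factS natrM.
rewrite [leRHS](_ : _ = nrm (1%:M : 'M[R[i]]_N) * c ^+ k * k`!%:R * (c * k.+1%:R)); last by ring.
rewrite ler_wpM2l ?mulr_ge0 ?exprn_ge0 ?addr_ge0// /c -natr1.
have k0 : 0 <= k%:R :> R by [].
have := mulr_ge0 nM k0; move: (k%:R : R) => y; nra.
Qed.

(** For large [k] the relation [k X = 1 - M X] for [X = (M + k)^-1] bounds [X] by
    [2 N / k]; the finitely many remaining [k] only change the constant. *)
Lemma nrm_invshift M : (forall s : nat, M + s%:R%:M \in unitmx) ->
  exists2 c : R, 0 <= c & forall k, nrm (invmx (M + k%:R%:M)) <= c / k.+1%:R.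
Proof.
move=> uM; pose X k := invmx (M + k%:R%:M).
pose n1 := nrm (1%:M : 'M[R[i]]_N); have n10 : 0 <= n1 := nrm_ge0 _.
(* From [k0] on, [nrm M <= k / 2]. *)
pose k0 := (Num.truncn (2 * nrm M + 1)).+1.
have k0M : 2 * nrm M + 1 <= k0%:R by rewrite ltW// truncnS_gt.
exists (4 * n1 + \sum_(k < k0) k.+1%:R * nrm (X k)) => [|k].
  by rewrite addr_ge0 ?mulr_ge0// sumr_ge0// => k _; rewrite mulr_ge0 ?nrm_ge0.
rewrite ler_pdivlMr// -/(X k).
have [kk0|kk0] := ltnP k k0.
  rewrite (bigD1 (Ordinal kk0))//= mulrC addrCA lerDl addr_ge0 ?mulr_ge0//.
  by rewrite sumr_ge0// => j _; rewrite mulr_ge0 ?nrm_ge0.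
have h : k%:R * nrm (X k) <= n1 + nrm M * nrm (X k).
  rewrite -normc_nat -nrmZ -mul_scalar_mx.
  rewrite (_ : k%:R%:M = (M + k%:R%:M) - M); last by rewrite addrC addKr.
  rewrite mulmxBl mulmxV//; apply: le_trans (nrmB _ _) _.
  by rewrite lerD2l nrmM.
have kM : 2 * nrm M + 1 <= k%:R by apply: le_trans k0M _; rewrite ler_nat.
apply: (@le_trans _ _ (4 * n1)); last first.
  by rewrite lerDl sumr_ge0// => j _; rewrite mulr_ge0 ?nrm_ge0.
have x0 := nrm_ge0 (X k); have m0 := nrm_ge0 M.
rewrite -natr1; move: h kM x0 m0; move: (nrm (X k)) (nrm M) (k%:R : R) => x m y.
move=> h1 h2 h3 h4.
have h5 : (2 * m + 1) * x <= y * x by rewrite ler_wpM2r.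
lra.
Qed.

Lemma nrm_invpoch_le M : (forall s : nat, M + s%:R%:M \in unitmx) ->
  exists c K, [/\ 0 <= c, 0 <= K &
  forall k, nrm (invmx (mxpoch M k)) <= K * c ^+ k / k`!%:R].
Proof.
move=> uM; have [c c0 hc] := nrm_invshift uM.
exists c, (nrm (1%:M : 'M[R[i]]_N)); split=> //; first exact: nrm_ge0.
elim=> [|k ih]; first by rewrite mxpoch0 invmx1 expr0 mulr1 divr1.
rewrite invmx_pochS//; apply: le_trans (nrmM _ _) _.
apply: le_trans (ler_pM (nrm_ge0 _) (nrm_ge0 _) (hc k) ih) _.
rewrite exprS factS natrM invfM le_eqVlt; apply/orP; left; apply/eqP; ring.
Qed.

Lemma nrm_prod_poch_le As : exists c K, [/\ 0 <= c, 0 <= K &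
  forall k, nrm (\prod_(A <- As) mxpoch A k) <= K * c ^+ k * k`!%:R ^+ size As].
Proof.
elim: As => [|A As [c [K [c0 K0 h]]]].
  exists 1, (nrm (1%:M : 'M[R[i]]_N)); split=> //; first exact: nrm_ge0.
  by move=> k; rewrite big_nil expr0 expr1n !mulr1.
have [d [L [d0 L0 h']]] := nrm_poch_le A.
exists (d * c), (L * K); split; [exact: mulr_ge0|exact: mulr_ge0|move=> k].
rewrite big_cons; apply: le_trans (nrmM _ _) _.
apply: le_trans (ler_pM (nrm_ge0 _) (nrm_ge0 _) (h' k) (h k)) _.
rewrite exprMn /= exprS le_eqVlt; apply/orP; left; apply/eqP; ring.
Qed.

Lemma nrm_prod_invpoch_le Bs :
  (forall B, B \in Bs -> forall s : nat, B + s%:R%:M \in unitmx) ->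
  exists c K, [/\ 0 <= c, 0 <= K & forall k,
    nrm (\prod_(B <- Bs) invmx (mxpoch B k)) <= K * c ^+ k / k`!%:R ^+ size Bs].
Proof.
elim: Bs => [_|B Bs ih uBs].
  exists 1, (nrm (1%:M : 'M[R[i]]_N)); split=> //; first exact: nrm_ge0.
  by move=> k; rewrite big_nil expr0 expr1n divr1 !mulr1.
have [|c [K [c0 K0 h]]] := ih.
  by move=> B' B'Bs; apply: uBs; rewrite inE B'Bs orbT.
have [d [L [d0 L0 h']]] := nrm_invpoch_le (uBs B (mem_head _ _)).
exists (d * c), (L * K); split; [exact: mulr_ge0|exact: mulr_ge0|move=> k].
rewrite big_cons; apply: le_trans (nrmM _ _) _.
apply: le_trans (ler_pM (nrm_ge0 _) (nrm_ge0 _) (h' k) (h k)) _.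
rewrite exprMn /= exprS invfM le_eqVlt; apply/orP; left; apply/eqP; ring.
Qed.

(** Each numerator symbol contributes a factor [c^k k!], each denominator symbol a
    factor [c^k / k!], and the series itself another [1 / k!]. *)
Lemma nrm_hyp_term_le As Bs z e : size Bs = (size As + e)%N ->
  (forall B, B \in Bs -> forall s : nat, B + s%:R%:M \in unitmx) ->
  exists c K, [/\ 0 <= c, 0 <= K & forall k,
    nrm (mxhyp_term As Bs z k) <= K * c ^+ k / k`!%:R ^+ e.+1].
Proof.
move=> sE uBs; have [c [K [c0 K0 h]]] := nrm_prod_poch_le As.
have [d [L [d0 L0 h']]] := nrm_prod_invpoch_le uBs.
exists (normc z * (c * d)), (K * L); split; rewrite ?mulr_ge0 ?normc_ge0// => k.
rewrite nrmZ Normc.normcM normcX Normc.normcV normc_nat.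
have zk : 0 <= normc z ^+ k / k`!%:R by rewrite divr_ge0 ?exprn_ge0 ?normc_ge0.
apply: le_trans (ler_wpM2l zk _) _.
  apply: le_trans (nrmM _ _) _; exact: (ler_pM (nrm_ge0 _) (nrm_ge0 _) (h k) (h' k)).
have k0 : k`!%:R != 0 :> R by rewrite pnatr_eq0 -lt0n fact_gt0.
rewrite sE !exprMn exprD exprS le_eqVlt; apply/orP; left; apply/eqP; field.
by rewrite k0 !expf_neq0.
Qed.

Lemma mxhyp_cvg As Bs z e : size Bs = (size As + e)%N ->
  (forall B, B \in Bs -> forall s : nat, B + s%:R%:M \in unitmx) ->
  mxcvg (fun n => \sum_(0 <= k < n) mxhyp_term As Bs z k) (mxhyp As Bs z).
Proof.
move=> sE uBs; have [c [K [c0 K0 h]]] := nrm_hyp_term_le z sE uBs.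
have [||L hL] := @mxseries_cvg _ _ (mxhyp_term As Bs z) (fun k => K * exp_coeff c k).
- move=> k; apply: le_trans (h k) _; rewrite -mulrA ler_wpM2l//.
  rewrite ler_wpM2l ?exprn_ge0// lef_pV2 ?posrE ?exprn_gt0 ?ltr0n ?fact_gt0//.
  by rewrite exprS ler_peMr// exprn_ege1// ler1n fact_gt0.
- exact: is_cvg_seriesZ (is_cvg_series_exp_coeff _).
- by rewrite /mxhyp (mxcvg_lim hL).
Qed.

Lemma exp_coeff_le (x : R) k : 0 <= x -> x ^+ k / k`!%:R <= expR x.
Proof.
move=> x0; apply: le_trans (expR_partial_le k.+1 x0).
rewrite big_nat_recr//= lerDr sumr_ge0// => i _.
by rewrite divr_ge0// exprn_ge0.
Qed.

(** When there is one more denominator parameter, the terms decrease like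
    [c^k / k!^2], so that the series is of order less than one: it is bounded by
    [K exp (eps t)] for every [eps > 0]. *)
Lemma hyp_growth As Bs z (eps : R) : size Bs = (size As).+1 ->
  (forall B, B \in Bs -> forall s : nat, B + s%:R%:M \in unitmx) -> 0 < eps ->
  exists2 K, 0 <= K & forall n t, 0 <= t ->
    \sum_(0 <= k < n) t ^+ k * nrm (mxhyp_term As Bs z k) <= K * expR (eps * t).
Proof.
move=> sE uBs eps0.
have sE' : size Bs = (size As + 1)%N by rewrite addn1.
have [c [K [c0 K0 h]]] := nrm_hyp_term_le z sE' uBs.
exists (K * expR (c / eps)) => [|n t t0]; first by rewrite mulr_ge0 ?expR_ge0.
have et0 : 0 <= eps * t by rewrite mulr_ge0// ltW.
apply: (@le_trans _ _ (\sum_(0 <= k < n)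
    (K * expR (c / eps)) * ((eps * t) ^+ k / k`!%:R))); last first.
  rewrite -mulr_sumr ler_wpM2l ?mulr_ge0 ?expR_ge0//.
  exact: expR_partial_le.
apply: ler_sum => k _.
have k0 : k`!%:R != 0 :> R by rewrite pnatr_eq0 -lt0n fact_gt0.
apply: le_trans (ler_wpM2l (exprn_ge0 k t0) (h k)) _.
have cE : (0 <= c / eps) by rewrite divr_ge0// ltW.
have := exp_coeff_le k cE; move: (expR (c / eps)) => y hy.
apply: (@le_trans _ _ ((K * ((c / eps) ^+ k / k`!%:R)) * ((eps * t) ^+ k / k`!%:R))).
  rewrite le_eqVlt; apply/orP; left; apply/eqP; rewrite !exprMn exprVn expr2; field.
  by rewrite k0 expf_neq0// gt_eqF.
rewrite ler_wpM2r ?divr_ge0 ?exprn_ge0//.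
by rewrite ler_wpM2l.
Qed.

End Pochhammer.

(** * Termwise integration *)

Section Termwise.
Context {R : realType} {N : nat}.
Implicit Types (E : R -> 'M[R[i]]_N) (As Bs : seq 'M[R[i]]_N) (z : R[i]) (t : R).
Local Notation mu := (@lebesgue_measure R).

Lemma is_derive_pow k t : is_derive t (1 : R) (fun x => x ^+ k) (k%:R * t ^+ k.-1).
Proof.
case: k => [|k].
  by rewrite mul0r; under eq_fun do rewrite expr0; exact: is_derive_cst.
have -> : (fun x : R => x ^+ k.+1) = id ^+ k.+1 by apply/funext => x; rewrite fctE.
by apply: is_derive_eq; rewrite /GRing.scale /= mulr1 mulr_natl.
Qed.

Lemma mxder_pow E k t M : mxder E t M ->
  mxder (fun x => (x ^+ k)%:C *: E x) t
    ((k%:R * t ^+ k.-1)%:C *: E t + (t ^+ k)%:C *: M).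
Proof. by move=> dE; apply: mxderZ dE; apply: cder_real; exact: is_derive_pow. Qed.

Lemma mxhyp_termZ As Bs z t k :
  mxhyp_term As Bs (z * t%:C) k = (t ^+ k)%:C *: mxhyp_term As Bs z k.
Proof.
rewrite /mxhyp_term scalerA exprMn rmorphXn; congr (_ *: _).
by rewrite mulrA [(t%:C) ^+ k * _]mulrC.
Qed.

Variables (D : set R) (u v : nat -> R) (E : R -> 'M[R[i]]_N) (g : R -> R) (eps : R).
Hypotheses (exh : exhausts D u v) (D0 : forall t, D t -> 0 <= t) (eps0 : 0 < eps).
Hypotheses (dE : forall t, D t -> exists M, mxder E t M).
Hypotheses (gi : mu.-integrable D (EFin \o g)).
Hypotheses (Eg : forall t, D t -> nrm (E t) * expR (eps * t) <= g t).

Let mD : measurable D := exh_measurable exh.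

Lemma moment_measurable k : mxmeasurable D (fun t => (t ^+ k)%:C *: E t).
Proof.
apply: (mxder_measurable exh) => t Dt; have [M hM] := dE Dt.
by eexists; exact: mxder_pow hM.
Qed.

Lemma moment_integrable k : mxintegrable D (fun t => (t ^+ k)%:C *: E t).
Proof.
apply: (mxintegrable_dom mD (moment_measurable k) (integrable_scale (k`!%:R / eps ^+ k) mD gi)).
move=> t Dt; have t0 := D0 Dt.
have et0 : 0 <= eps * t by rewrite mulr_ge0// ltW.
rewrite nrmZ normc_real ger0_norm ?exprn_ge0//.
have k0 : 0 < k`!%:R / eps ^+ k :> R by rewrite divr_gt0 ?exprn_gt0// ltr0n fact_gt0.
apply: le_trans (ler_wpM2l (ltW k0) (Eg Dt)).
rewrite [leRHS]mulrCA mulrC ler_wpM2l ?nrm_ge0//.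
have := exp_coeff_le k et0; rewrite exprMn => h.
apply: le_trans (ler_wpM2l (ltW k0) h).
rewrite le_eqVlt; apply/orP; left; apply/eqP; field.
by rewrite expf_neq0 ?gt_eqF// ltr0n fact_gt0.
Qed.

(** Dominated convergence of the partial sums: the majorant is [nrm E(t)] times the
    bound [K exp (eps t)] of [hyp_growth], which is what [Eg] makes integrable. *)
Lemma mxhyp_integral As Bs z (V T : nat -> 'M[R[i]]_N) S :
  size Bs = (size As).+1 ->
  (forall B, B \in Bs -> forall s : nat, B + s%:R%:M \in unitmx) ->
  (forall k, mxintegral D (fun t => (t ^+ k)%:C *: E t) = mxintegral D E *m V k) ->
  (forall k, V k *m mxhyp_term As Bs z k = T k) ->
  mxcvg (fun n => \sum_(0 <= k < n) T k) S ->
  mxintegrable D (fun t => E t *m mxhyp As Bs (z * t%:C)) /\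
  mxintegral D (fun t => E t *m mxhyp As Bs (z * t%:C)) = mxintegral D E *m S.
Proof.
move=> sE uBs mom VT TS.
pose F n t := \sum_(0 <= k < n) ((t ^+ k)%:C *: E t) *m mxhyp_term As Bs z k.
have sE' : size Bs = (size As + 1)%N by rewrite addn1.
have [K K0 hK] := hyp_growth z sE uBs eps0.
have Fsum n := mxintegrable_sum (index_iota 0 n) mD
  (fun k => mxintegrableMr (mxhyp_term As Bs z k) mD (moment_integrable k)).
have FE n t : F n t = E t *m \sum_(0 <= k < n) mxhyp_term As Bs (z * t%:C) k.
  rewrite mulmx_sumr; apply: eq_bigr => k _.
  by rewrite mxhyp_termZ; move: (mxhyp_term _ _ _ _) => W; rewrite -scalemxAl -scalemxAr.
have Fcvg t : D t -> mxcvg (F ^~ t) (E t *m mxhyp As Bs (z * t%:C)).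
  move=> _; rewrite (_ : F ^~ t = fun n => E t *m
    \sum_(0 <= k < n) mxhyp_term As Bs (z * t%:C) k); last by apply/funext => n.
  by apply: mxcvg_mull; exact: mxhyp_cvg sE' uBs.
have Fle n t : D t -> nrm (F n t) <= K * g t.
  move=> Dt; have t0 := D0 Dt.
  apply: le_trans (ler_wpM2l K0 (Eg Dt)); rewrite mulrCA.
  apply: le_trans (ler_wpM2l (nrm_ge0 _) (hK n t t0)).
  rewrite mulr_sumr; apply: le_trans (nrm_sum _ _ _) _; apply: ler_sum => k _.
  rewrite -scalemxAl nrmZ normc_real ger0_norm ?exprn_ge0// mulrCA.
  by rewrite ler_wpM2l ?exprn_ge0// nrmM.
have Fmeas n : mxmeasurable D (F n).
  move=> i j; have [h1 h2] := (Fsum n).1 i j.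
  by split; apply/measurable_EFinP; [exact: measurable_int h1|exact: measurable_int h2].
have [Gi Gcvg] := mxintegral_dct mD Fmeas Fcvg (integrable_scale K mD gi) Fle.
split=> //; apply: mxcvg_unique Gcvg _.
rewrite (_ : (fun n => _) = fun n => mxintegral D E *m \sum_(0 <= k < n) T k).
  exact: mxcvg_mull.
apply/funext => n; rewrite (Fsum n).2 mulmx_sumr; apply: eq_bigr => k _.
by rewrite mxintegralMr// ?mom -?mulmxA ?VT//; exact: moment_integrable.
Qed.

(** Integration by parts: the derivative of [phi E] is [E (phi' + phi L)], and the
    factor [phi] is there to clear the denominators of [L] and to vanish fast enough
    at the ends of [D]. *)
Lemma moment_rec (L : R -> 'M[R[i]]_N) (phi dphi : R -> R) X Y k :
  (forall t, D t -> mxder E t (E t *m L t)) ->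
  (forall t, D t -> is_derive t (1 : R) phi (dphi t)) ->
  (forall t, D t -> (dphi t)%:C%:M + (phi t)%:C *: L t =
     (t ^+ k)%:C *: X - (t ^+ k.+1)%:C *: Y) ->
  mxcvg (fun n => (phi (u n))%:C *: E (u n)) 0 ->
  mxcvg (fun n => (phi (v n))%:C *: E (v n)) 0 ->
  mxintegral D (fun t => (t ^+ k)%:C *: E t) *m X =
  mxintegral D (fun t => (t ^+ k.+1)%:C *: E t) *m Y.
Proof.
move=> dEL dphi' eqL hu hv.
pose J k t := (t ^+ k)%:C *: E t.
pose F t := J k t *m X + J k.+1 t *m - Y.
have Fi1 := mxintegrableMr X mD (moment_integrable k).
have Fi2 := mxintegrableMr (- Y) mD (moment_integrable k.+1).
have [Fi FE] : mxintegrable D F /\ mxintegral D F =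
    mxintegral D (J k) *m X + mxintegral D (J k.+1) *m - Y.
  have fi (b : bool) : mxintegrable D
      (fun t => if b then J k t *m X else J k.+1 t *m - Y) by case: b.
  have [] := mxintegrable_sum [:: true; false] mD fi.
  rewrite big_cons big_seq1 /= !mxintegralMr//; last first.
  - exact: moment_integrable.
  - exact: moment_integrable.
  move=> h1 <-; split.
    by apply: mxintegrable_ext h1 => // t _; rewrite big_cons big_seq1.
  by apply: mxintegral_ext => t _; rewrite big_cons big_seq1.
have dH t : D t -> mxder (fun t => (phi t)%:C *: E t) t (F t).
  move=> Dt; apply: mxder_eq (mxderZ (cder_real (dphi' t Dt)) (dEL t Dt)) _.
  rewrite /F /J -!scalemxAl -mul_mx_scalar; move: (E t) (L t) (eqL t Dt) => M W eqW.
  by rewrite scalemxAr -mulmxDr eqW mulmxBr -!scalemxAr mulmxN scalerN.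
have dF t : D t -> exists M, mxder F t M.
  move=> Dt; have [M hM] := dE Dt; eexists.
  exact: mxderD (mxderM (mxder_pow k hM) (mxder_cst X t))
    (mxderM (mxder_pow k.+1 hM) (mxder_cst (- Y) t)).
have F0 := mxintegral_derivative0 exh dH dF Fi hu hv.
by apply/eqP; rewrite -subr_eq0 -mulmxN -FE F0.
Qed.

End Termwise.

(** * Moments of the beta and Laplace kernels *)

Section Kernels.
Context {R : realType} {N : nat}.
Implicit Types (P Q : 'M[R[i]]_N) (s z : R[i]) (t x : R).
Local Notation mu := (@lebesgue_measure R).

Lemma cvg_inv2 : (n.+2%:R^-1 : R) @[n --> \oo] --> (0 : R).
Proof. by have := @cvg_harmonic R; rewrite -(cvg_shiftS (@harmonic R)). Qed.

Lemma cvg_inv3 : (n.+3%:R^-1 : R) @[n --> \oo] --> (0 : R).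
Proof. by have := cvg_inv2; rewrite -(cvg_shiftS (fun n => n.+2%:R^-1 : R)). Qed.

(** The product [t t^(a - 1) = t^a] tends to 0: the boundary terms of the
    integrations by parts vanish. *)
Lemma tpow_vanish P (x : nat -> R) : decays P -> (forall n, 0 < x n <= 1) ->
  x n @[n --> \oo] --> (0 : R) ->
  mxcvg (fun n => (x n)%:C *: tpow (x n) (P - 1%:M)) 0.
Proof.
move=> /tpow_le1[a [K [a0 K0 hK]]] x01 xc.
have ec : K * expR (a * ln (x n)) @[n --> \oo] --> (0 : R).
  rewrite -[X in _ --> X](mulr0 K); apply: cvgM; first exact: cvg_cst.
  apply/cvgrPdist_le => e e0.
  have e1 : 0 < expR (ln e / a) by exact: expR_gt0.
  have /cvgrPdist_le/(_ _ e1) := xc; apply: filterS => n.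
  have /andP[xn0 xn1] := x01 n.
  rewrite !sub0r !normrN !ger0_norm ?expR_ge0 ?(ltW xn0)// => hx.
  rewrite -[leRHS]lnK ?posrE// ler_expR mulrC -ler_pdivlMr//.
  by rewrite -(expRK (ln e / a)) ler_ln ?posrE.
rewrite /mxcvg; apply: squeeze_cvgr ec; last exact: cvg_cst.
apply: nearW => n; rewrite nrm_ge0 subr0 nrmZ normc_real /=.
have /andP[xn0 xn1] := x01 n.
rewrite ger0_norm ?(ltW xn0)//.
apply: le_trans (ler_wpM2l (ltW xn0) (hK _ (x01 n))) _.
rewrite mulrCA ler_wpM2l// -{1}(lnK xn0) -expRD ler_expR; lra.
Qed.

Lemma tpow_bounded P : decays P -> exists2 C, 0 <= C &
  forall t, 2^-1 <= t <= 1 -> nrm (tpow t (P - 1%:M)) <= C.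
Proof.
move=> /tpow_le1[a [K [a0 K0 hK]]].
exists (K * expR (`|a - 1| * ln 2)) => [|t /andP[t2 t1]].
  by rewrite mulr_ge0 ?expR_ge0.
have t0 : 0 < t by apply: lt_le_trans t2.
apply: le_trans (hK t _) _; rewrite ?t0// ler_wpM2l//.
by rewrite pow_half_le// t2.
Qed.

(** The coefficient [phi' + phi L] of the derivative of [phi E], for the beta kernel,
    with [p = t^k (1 - t)] and [q = t^(k + 1)], so that [p + q = t^k]. *)
Lemma beta_scalars P Q k (p q : R[i]) :
  (k.+1%:R * p - q)%:M + (p *: (P - 1%:M) - q *: (Q - 1%:M)) =
  (p + q) *: (P + k%:R%:M) - q *: (P + Q + k%:R%:M).
Proof. by apply/matrixP => i j; rewrite !mxE -natr1; case: (i == j); rewrite ?mulr1n ?mulr0n; ring. Qed.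

(** The same coefficient for the Laplace kernel, with [r = t^k] and [q = t^(k + 1)]. *)
Lemma laplace_scalars P k (r q s : R[i]) :
  (k.+1%:R * r)%:M + (r *: (P - 1%:M) - q *: s%:M) =
  r *: (P + k%:R%:M) - q *: s%:M.
Proof. by apply/matrixP => i j; rewrite !mxE -natr1; case: (i == j); rewrite ?mulr1n ?mulr0n; ring. Qed.

Definition beta_kernel P Q t := tpow t (P - 1%:M) *m tpow (1 - t) (Q - 1%:M).

Definition laplace_kernel s P t := cexp (- s * t%:C) *: tpow t (P - 1%:M).

Lemma mxder_beta P Q t : comm_mx P Q -> 0 < t < 1 ->
  mxder (beta_kernel P Q) t (beta_kernel P Q t *m
    ((t^-1)%:C *: (P - 1%:M) - ((1 - t)^-1)%:C *: (Q - 1%:M))).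
Proof.
move=> cPQ /andP[t0 t1]; have t1' : 0 < 1 - t by rewrite subr_gt0.
have d1 : is_derive t (1 : R) (fun t => 1 - t) (-1).
  by apply: is_derive_eq; rewrite add0r mul1r.
have h := @mxder_comp _ _ (fun t => tpow t (Q - 1%:M)) (fun t => 1 - t) t _ _ (mxder_tpow (Q - 1%:M) t1') d1.
apply: mxder_eq (mxderM (mxder_tpow (P - 1%:M) t0) h) _.
have cP1Q1 : comm_mx (P - 1%:M) (Q - 1%:M).
  apply: comm_mxB; last exact: comm_mx1.
  by apply/comm_mx_sym/comm_mxB; [exact: comm_mx_sym|exact: comm_mx1].
rewrite /beta_kernel.
have c1 := comm_tpow t (comm_mx_refl (P - 1%:M)).
have c2 := comm_tpow (1 - t) cP1Q1.
have c3 := comm_tpow (1 - t) (comm_mx_refl (Q - 1%:M)).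
move: c1 c2 c3; rewrite /comm_mx.
move: (tpow t (P - 1%:M)) (tpow (1 - t) (Q - 1%:M)) => X Y.
move: (P - 1%:M) (Q - 1%:M) => P1 Q1 c1 c2 c3.
have -> : (-1 : R)%:C = -1 by rewrite rmorphN.
rewrite scaleN1r mulmxN mulmxBr -!scalemxAr -scalemxAl c3 c1 -!mulmxA c2.
by rewrite mulmxA.
Qed.

Lemma mxder_laplace s P t : 0 < t ->
  mxder (laplace_kernel s P) t (laplace_kernel s P t *m
    ((t^-1)%:C *: (P - 1%:M) - s%:M)).
Proof.
move=> t0; rewrite /laplace_kernel.
under [X in mxder X]eq_fun do rewrite [- s * _]mulrC.
apply: mxder_eq (mxderZ (cder_cexp (- s) t) (mxder_tpow (P - 1%:M) t0)) _.
have c1 := comm_tpow t (comm_mx_refl (P - 1%:M)).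
rewrite [- s * _]mulrC; move: c1; rewrite /comm_mx.
move: (tpow t (P - 1%:M)) (cexp _) => X w; move: (P - 1%:M) => P1 c1.
rewrite -scalemxAl mulmxBr mul_mx_scalar -scalemxAr c1 scalerBr addrC.
by rewrite mulNr scaleNr [s * w]mulrC -scalerA.
Qed.

Lemma normc_laplace s t : normc (cexp (- s * t%:C)) = expR (- complex.Re s * t).
Proof. by rewrite normc_cexp Re_mul /= mulr0 subr0 raddfN. Qed.

(** Half of the decay of [exp (- s t)] is reserved for the growth of the
    hypergeometric series. *)
Lemma laplace_kernel_majorant s P : decays P -> 0 < complex.Re s ->
  exists2 g : R -> R, mu.-integrable `]0, +oo[ (EFin \o g) & forall t, `]0, +oo[%classic t ->
    nrm (laplace_kernel s P t) * expR (complex.Re s / 2 * t) <= g t.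
Proof.
move=> dP s0; have s20 : 0 < complex.Re s / 2 by rewrite divr_gt0.
have [g [_ gi hg]] := laplace_majorant dP s20; exists g => // t.
rewrite /= in_itv /= andbT => t0; apply: le_trans (hg t t0).
rewrite nrmZ normc_laplace mulrAC -expRD ler_wpM2r ?nrm_ge0// ler_expR; lra.
Qed.

Lemma beta_kernel_majorant P Q : decays P -> decays Q ->
  exists2 g : R -> R, mu.-integrable `]0, 1[ (EFin \o g) & forall t, `]0, 1[%classic t ->
    nrm (beta_kernel P Q t) * expR (1 * t) <= g t.
Proof.
move=> dP dQ; have [g gi hg] := beta_majorant dP dQ.
exists (fun t => expR 1 * g t).
  by apply: integrable_scale => //; exact: measurable_itv.
move=> t; rewrite /= in_itv /= => t01; have /andP[t0 t1] := t01.
rewrite mulrC; apply: ler_pM; rewrite ?expR_ge0 ?nrm_ge0 ?ler_expR ?mul1r ?(ltW t1)//.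
exact: le_trans (nrmM _ _) (hg t t01).
Qed.

Lemma boundary_le (w a b C : R) : 0 < w -> w <= 1 -> 0 <= a -> 0 <= b -> b <= C ->
  w * (1 - w) * (a * b) <= C * (w * a).
Proof.
move=> w0 w1 a0 b0 bC; rewrite (_ : _ * _ = w * a * ((1 - w) * b)); last by ring.
rewrite [leRHS]mulrC ler_wpM2l ?mulr_ge0 ?(ltW w0)//.
by apply: le_trans bC; rewrite ler_piMl//; lra.
Qed.

Lemma beta_moment P Q k : comm_mx P Q -> decays P -> decays Q ->
  mxintegral `]0, 1[ (fun t => (t ^+ k)%:C *: beta_kernel P Q t) *m (P + k%:R%:M) =
  mxintegral `]0, 1[ (fun t => (t ^+ k.+1)%:C *: beta_kernel P Q t) *m
    (P + Q + k%:R%:M).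
Proof.
move=> cPQ dP dQ; have [g gi hg] := beta_kernel_majorant dP dQ.
pose phi t := t ^+ k.+1 * (1 - t).
pose dphi t := k.+1%:R * t ^+ k * (1 - t) - t ^+ k.+1.
have D0 t : `]0, 1[%classic t -> 0 <= t by rewrite /= in_itv /= => /andP[/ltW].
have dE t : `]0, 1[%classic t -> exists M, mxder (beta_kernel P Q) t M.
  by rewrite /= in_itv /= => t01; eexists; exact: mxder_beta.
have nH t : 0 < t < 1 -> nrm ((phi t)%:C *: beta_kernel P Q t) <=
    t * (1 - t) * (nrm (tpow t (P - 1%:M)) * nrm (tpow (1 - t) (Q - 1%:M))).
  move=> /andP[t0 t1]; have t1' : 0 <= 1 - t by rewrite subr_ge0 ltW.
  rewrite nrmZ normc_real ger0_norm ?mulr_ge0 ?exprn_ge0 ?(ltW t0)//.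
  apply: ler_pM; rewrite ?mulr_ge0 ?exprn_ge0 ?nrm_ge0 ?(ltW t0)//; last exact: nrmM.
  by rewrite ler_wpM2r// exprS ler_piMr ?(ltW t0)// exprn_ile1 ?(ltW t0) ?(ltW t1).
have x3 n : 0 < (n.+3%:R^-1 : R) <= 1 by rewrite invr_gt0 ltr0n invf_le1 ?ler1n.
(* The ends of the exhausting intervals are within 1/3 of 0 and 1, so that the factor
   which is not singular there has its argument in [1/2, 1]. *)
have x3' n : 2^-1 <= 1 - (n.+3%:R^-1 : R) <= 1.
  have : (n.+3%:R^-1 : R) <= 3^-1 by rewrite lef_pV2 ?posrE// ler_nat.
  by have /andP[] := x3 n; move: (n.+3%:R^-1 : R) => y y0 y1 y2; apply/andP; split; lra.
have x01 n : 0 < (n.+3%:R^-1 : R) < 1 by rewrite invr_gt0 ltr0n invf_lt1 ?ltr1n.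
apply: (moment_rec exhausts01 D0 ltr01 dE gi hg
  (L := fun t => (t^-1)%:C *: (P - 1%:M) - ((1 - t)^-1)%:C *: (Q - 1%:M))
  (phi := phi) (dphi := dphi)).
- by move=> t; rewrite /= in_itv /= => t01; exact: mxder_beta.
- move=> t _; have dp := is_derive_pow k.+1 t.
  apply: is_derive_eq; rewrite /GRing.scale /= /dphi; ring.
- move=> t; rewrite /= in_itv /= => /andP[t0 t1].
  have e1 : phi t * t^-1 = t ^+ k * (1 - t).
    by rewrite /phi exprS; field; rewrite gt_eqF.
  have e2 : phi t * (1 - t)^-1 = t ^+ k.+1.
    by rewrite /phi mulfK// gt_eqF// subr_gt0.
  have e3 : t ^+ k = t ^+ k * (1 - t) + t ^+ k.+1 by rewrite exprS; ring.
  have e4 : (dphi t)%:C = k.+1%:R * (t ^+ k * (1 - t))%:C - (t ^+ k.+1)%:C.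
    by rewrite /dphi -mulrA rmorphB rmorphM rmorph_nat.
  have e5 : (t ^+ k)%:C = (t ^+ k * (1 - t))%:C + (t ^+ k.+1)%:C.
    by rewrite -rmorphD -e3.
  rewrite scalerBr !scalerA -!rmorphM e1 e2 e4 [in RHS]e5.
  exact: beta_scalars.
- have [C C0 hC] := tpow_bounded dQ.
  apply: (mxcvg_lip (c := C) (tpow_vanish dP x3 cvg_inv3)) => n.
  rewrite !subr0; apply: le_trans (nH _ (x01 n)) _.
  rewrite nrmZ normc_real ger0_norm; last by case/andP: (x3 n) => /ltW.
  have /andP[w0 w1] := x3 n.
  exact: boundary_le w0 w1 (nrm_ge0 _) (nrm_ge0 _) (hC _ (x3' n)).
- have [C C0 hC] := tpow_bounded dP.
  apply: (mxcvg_lip (c := C) (tpow_vanish dQ x3 cvg_inv3)) => n.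
  have e1 : 1 - (1 - n.+3%:R^-1 : R) = n.+3%:R^-1 by rewrite opprB addrCA subrr addr0.
  have x01' : 0 < 1 - (n.+3%:R^-1 : R) < 1.
    by have /andP[] := x01 n; move: (n.+3%:R^-1 : R) => y ? ?; apply/andP; split; lra.
  rewrite !subr0; apply: le_trans (nH _ x01') _.
  rewrite e1 nrmZ normc_real ger0_norm; last by case/andP: (x3 n) => /ltW.
  have /andP[w0 w1] := x3 n; rewrite [X in X * _]mulrC [X in _ * X]mulrC.
  exact: boundary_le w0 w1 (nrm_ge0 _) (nrm_ge0 _) (hC _ (x3' n)).
Qed.

Lemma laplace_moment s P k : decays P -> 0 < complex.Re s ->
  mxintegral `]0, +oo[ (fun t => (t ^+ k)%:C *: laplace_kernel s P t) *m (P + k%:R%:M) =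
  mxintegral `]0, +oo[ (fun t => (t ^+ k.+1)%:C *: laplace_kernel s P t) *m s%:M.
Proof.
move=> dP s0; have [g gi hg] := laplace_kernel_majorant dP s0.
have s20 : 0 < complex.Re s / 2 by rewrite divr_gt0.
have D0 t : `]0, +oo[%classic t -> 0 <= t by rewrite /= in_itv /= andbT => /ltW.
have dE t : `]0, +oo[%classic t -> exists M, mxder (laplace_kernel s P) t M.
  by rewrite /= in_itv /= andbT => t0; eexists; exact: mxder_laplace.
have x2 n : 0 < (n.+2%:R^-1 : R) <= 1 by rewrite invr_gt0 ltr0n invf_le1 ?ler1n.
apply: (moment_rec exhausts0y D0 s20 dE gi hg
  (L := fun t => (t^-1)%:C *: (P - 1%:M) - s%:M)
  (phi := fun t => t ^+ k.+1) (dphi := fun t => k.+1%:R * t ^+ k)).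
- by move=> t; rewrite /= in_itv /= andbT => t0; exact: mxder_laplace.
- by move=> t _; exact: is_derive_pow.
- move=> t; rewrite /= in_itv /= andbT => t0.
  have e1 : t ^+ k.+1 * t^-1 = t ^+ k by rewrite exprSr mulfK// gt_eqF.
  have e2 : (k.+1%:R * t ^+ k)%:C = k.+1%:R * (t ^+ k)%:C.
    by rewrite rmorphM rmorph_nat.
  rewrite scalerBr scalerA -rmorphM e1 e2.
  exact: laplace_scalars.
- apply: (mxcvg_lip (c := 1) (tpow_vanish dP x2 cvg_inv2)) => n.
  rewrite !subr0 mul1r !nrmZ !normc_real normc_laplace.
  have /andP[] := x2 n; move: (n.+2%:R^-1 : R) => w w0 w1.
  rewrite !ger0_norm ?exprn_ge0 ?(ltW w0)// mulrA ler_wpM2r ?nrm_ge0//.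
  rewrite exprS -mulrA ler_piMr ?(ltW w0)// mulr_ile1 ?exprn_ge0 ?expR_ge0 ?(ltW w0)//.
    by rewrite exprn_ile1// ltW.
  by rewrite -expR0 ler_expR mulNr oppr_le0 mulr_ge0 ?(ltW w0) ?(ltW s0).
- have [K K0 hK] := tpow_ge1 (P - 1%:M).
  set m := nrm (P - 1%:M) in hK.
  have m0 : 0 <= m + k.+1%:R by rewrite addr_ge0 ?nrm_ge0.
  have [C C0 hC] := pow_le_exp m0 s20.
  have c0 : K * C / (complex.Re s / 2) * n.+2%:R^-1 @[n --> \oo] --> (0 : R).
    rewrite -[X in _ --> X](mulr0 (K * C / (complex.Re s / 2))).
    by apply: cvgM; [exact: cvg_cst|exact: cvg_inv2].
  rewrite /mxcvg; apply: squeeze_cvgr c0; last exact: cvg_cst.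
  apply: nearW => n; rewrite nrm_ge0 subr0 !nrmZ normc_real normc_laplace /=.
  have t1 : 1 <= (n.+2%:R : R) by rewrite ler1n.
  move: (n.+2%:R : R) t1 => t t1; have t0 : 0 < t by apply: lt_le_trans t1.
  rewrite ger0_norm ?exprn_ge0 ?(ltW t0)//.
  set r := complex.Re s / 2 in s20 hC *.
  apply: (@le_trans _ _ (K * C * expR (- (r * t)))).
    rewrite mulrCA mulrA.
    have e0 : 0 <= expR (- complex.Re s * t) * t ^+ k.+1.
      by rewrite mulr_ge0 ?expR_ge0 ?exprn_ge0 ?(ltW t0).
    apply: le_trans (ler_wpM2l e0 (hK t t1)) _.
    have -> : t ^+ k.+1 = expR (k.+1%:R * ln t).
      by rewrite expRM_natl lnK.
    have := hC t t0; rewrite mulrDl expRD => h.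
    rewrite (_ : _ * (K * _) = K * expR (- complex.Re s * t) *
      (expR (m * ln t) * expR (k.+1%:R * ln t))); last by ring.
    have e1 : 0 <= K * expR (- complex.Re s * t) by rewrite mulr_ge0 ?expR_ge0.
    apply: le_trans (ler_wpM2l e1 h) _.
    rewrite mulrACA -expRD ler_wpM2l ?mulr_ge0// ler_expR /r; lra.
  rewrite -[leRHS]mulrA -invfM ler_wpM2l ?mulr_ge0// expRN lef_pV2 ?posrE ?expR_gt0 ?mulr_gt0//.
  by apply: le_trans (expR_ge1Dx _); rewrite lerDr.
Qed.

End Kernels.

(** * The Laplace transform of a matrix power *)

Section LaplaceBase.
Context {R : realType}.
Implicit Types (s z : R[i]) (t x a : R).
Local Notation mu := (@lebesgue_measure R).

Lemma acos_lt_pihalf (y : R) : 0 < y <= 1 -> acos y < pi / 2.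
Proof.
move=> /andP[y0 y1]; have y11 : -1 <= y <= 1 by apply/andP; split; lra.
have [/andP[a0 api] ay] := acos_def y11.
rewrite ltNge; apply/negP => api2.
have := @cos_ge0_pihalf R (acos y - pi).
have -> : (- (pi / 2) <= acos y - pi <= pi / 2) by apply/andP; split; lra.
move=> /(_ isT); have := cosDpi (acos y - pi); rewrite subrK ay => yE c0; lra.
Qed.

Lemma normc_gt0 s : 0 < complex.Re s -> 0 < normc s.
Proof. by move=> s0; apply: lt_le_trans (Re_le_normc s); rewrite gtr0_norm. Qed.

Lemma Re_div_normc s : 0 < complex.Re s -> 0 < complex.Re s / normc s <= 1.
Proof.
move=> s0; have n0 := normc_gt0 s0.
by rewrite divr_gt0// ler_pdivrMr// mul1r (le_trans (ler_norm _) (Re_le_normc s)).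
Qed.

Lemma carg_lt_pihalf s : 0 < complex.Re s -> `|carg s| < pi / 2.
Proof.
move=> s0; have y01 := Re_div_normc s0.
have y11 : -1 <= complex.Re s / normc s <= 1.
  by have /andP[y0 y1] := y01; apply/andP; split; lra.
rewrite /carg; have := acos_lt_pihalf y01; have := acos_ge0 y11.
by case: ifP => _ a0; rewrite ?normrN ger0_norm.
Qed.

Lemma cexp_cln s : 0 < complex.Re s -> cexp (cln s) = s.
Proof.
move=> s0; have n0 := normc_gt0 s0.
have y11 : -1 <= complex.Re s / normc s <= 1.
  by have /andP[y0 y1] := Re_div_normc s0; apply/andP; split; lra.
have nE : normc s ^+ 2 = complex.Re s ^+ 2 + complex.Im s ^+ 2.
  by case: (s) => a b /=; rewrite sqr_sqrtr// addr_ge0 ?sqr_ge0.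
have sinE : normc s * sin (acos (complex.Re s / normc s)) = `|complex.Im s|.
  rewrite sin_acos// -{1}(ger0_norm (ltW n0)) -sqrtr_sqr -sqrtrM ?sqr_ge0//.
  rewrite mulrBr mulr1 -exprMn mulrC divfK ?gt_eqF// nE addrC addKr.
  by rewrite sqrtr_sqr.
have cosE : normc s * cos (acos (complex.Re s / normc s)) = complex.Re s.
  by rewrite acosK ?in_itv//= mulrC divfK ?gt_eqF.
rewrite cexpE /cln /= lnK ?posrE// /carg; case: ifP => im.
  by rewrite cosE sinE ger0_norm//; case: (s).
rewrite cosN sinN mulrN cosE sinE ltr0_norm ?opprK; first by case: (s).
by rewrite ltNge im.
Qed.

Lemma cder_cexp_comp (f : R -> R[i]) x d : cder f x d ->
  cder (fun y => cexp (f y)) x (d * cexp (f x)).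
Proof.
move=> [f1 f2]; split; rewrite cexpE; under eq_fun do rewrite cexpE.
  rewrite Re_mul /=; apply: is_derive_eq; rewrite /GRing.scale /=; ring.
rewrite Im_mul /=; apply: is_derive_eq; rewrite /GRing.scale /=; ring.
Qed.

Lemma is_derive_under_integral (D : set R) (f df : R -> R -> R) (g : R -> R) a r :
  measurable D -> 0 < r ->
  (forall x, a - r < x < a + r -> mu.-integrable D (EFin \o f x)) ->
  (forall x t, a - r < x < a + r -> D t -> is_derive x (1 : R) (f^~ t) (df x t)) ->
  (forall t, 0 <= g t) -> mu.-integrable D (EFin \o g) ->
  (forall x t, a - r < x < a + r -> D t -> `|df x t| <= g t) ->
  is_derive a (1 : R) (fun x => \int[mu]_(t in D) f x t) (\int[mu]_(t in D) df a t).
Proof.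
move=> mD r0 fi dfx g0 gi dfg.
have Ia : `]a - r, a + r[%classic a by rewrite /= in_itv /=; apply/andP; split; lra.
have in_I x : `]a - r, a + r[%classic x -> a - r < x < a + r by rewrite /= in_itv.
have parE x t : a - r < x < a + r -> D t -> partial1of2 f x t = df x t.
  by move=> xI Dt; rewrite /partial1of2 derive1E; case: (dfx x t xI Dt).
have h1 x : `]a - r, a + r[%classic x -> mu.-integrable D (EFin \o f x).
  by move=> /in_I; exact: fi.
have h2 x t : `]a - r, a + r[%classic x -> D t -> derivable (f^~ t) x 1.
  by move=> /in_I xI Dt; case: (dfx x t xI Dt).
have h3 x t : `]a - r, a + r[%classic x -> D t -> `|partial1of2 f x t| <= g t.
  by move=> /in_I xI Dt; rewrite parE// dfg.
split; first exact: (@derivable_under_integral _ _ _ mu f D mD a _ _ Ia h1 h2 g g0 gi h3).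
have := @differentiation_under_integral _ _ _ mu f D mD a _ _ Ia h1 h2 g g0 gi h3.
rewrite derive1E => ->; apply: eq_Rintegral => t /set_mem Dt.
by rewrite parE//; exact: in_I.
Qed.

Lemma normc_speed (k w : R[i]) t : 0 <= t ->
  normc (- k * w * t%:C) = normc k * normc w * t.
Proof.
by move=> t0; rewrite !mulNr [LHS]normcN !Normc.normcM normc_real ger0_norm.
Qed.

Lemma mul_le_norm (x y : R) : -1 <= x <= 2 -> x * y <= 2 * `|y|.
Proof.
move=> /andP[x1 x2]; apply: le_trans (ler_norm _) _; rewrite normrM ler_wpM2r//.
by rewrite ler_norml; apply/andP; split; lra.
Qed.

Section Matrix.
Context {N : nat}.
Implicit Types (P : 'M[R[i]]_N).

Lemma mxder_under_integral (D : set R) (K dK : R -> R -> 'M[R[i]]_N) (g : R -> R) a r :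
  measurable D -> 0 < r ->
  (forall x, a - r < x < a + r -> mxintegrable D (K x)) ->
  (forall x t, a - r < x < a + r -> D t -> mxder (K^~ t) x (dK x t)) ->
  (forall t, 0 <= g t) -> mu.-integrable D (EFin \o g) ->
  (forall x t, a - r < x < a + r -> D t -> nrm (dK x t) <= g t) ->
  mxder (fun x => mxintegral D (K x)) a (mxintegral D (dK a)).
Proof.
move=> mD r0 Ki dKx g0 gi dKg i j; rewrite mxintegralE.
under eq_fun do rewrite mxintegralE.
split.
  apply: (@is_derive_under_integral D (fun x t => complex.Re (K x t i j))
    (fun x t => complex.Re (dK x t i j)) g a r) => // x.
  - by move=> xI; case: (Ki x xI i j).
  - by move=> t xI Dt; case: (dKx x t xI Dt i j).
  - move=> t xI Dt; apply: le_trans (Re_le_normc _) _.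
    exact: le_trans (normc_le_nrm _ _ _) (dKg x t xI Dt).
apply: (@is_derive_under_integral D (fun x t => complex.Im (K x t i j))
  (fun x t => complex.Im (dK x t i j)) g a r) => // x.
- by move=> xI; case: (Ki x xI i j).
- by move=> t xI Dt; case: (dKx x t xI Dt i j).
- move=> t xI Dt; apply: le_trans (Im_le_normc _) _.
  exact: le_trans (normc_le_nrm _ _ _) (dKg x t xI Dt).
Qed.

Lemma measurable_0y : measurable (`]0 : R, +oo[ : set R).
Proof. exact: exh_measurable exhausts0y. Qed.

Lemma laplace_integrable s P : decays P -> 0 < complex.Re s ->
  mxintegrable `]0, +oo[ (laplace_kernel s P).
Proof.
move=> dP s0; have [g gi hg] := laplace_kernel_majorant dP s0.
apply: (mxintegrable_dom measurable_0y _ gi).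
  apply: (mxder_measurable exhausts0y) => t; rewrite /= in_itv /= andbT => t0.
  by eexists; exact: mxder_laplace.
move=> t Dt; apply: le_trans (hg t Dt); rewrite ler_peMr ?nrm_ge0// -expR0 ler_expR.
move: Dt; rewrite /= in_itv /= andbT => /ltW t0.
by rewrite mulr_ge0// divr_ge0// ltW.
Qed.

(** Along a path [sg] with [sg' = k sg] in the right half-plane, the Laplace
    transform [H] of [t^(P - 1)] satisfies [H' = - k H P], because integration by
    parts turns the derivative under the integral into [H P]. *)
Lemma laplace_path (k : R[i]) (sg : R -> R[i]) (M : R) P : decays P ->
  (forall x, 0 <= x <= 1 -> 0 < complex.Re (sg x)) ->
  (forall x, cder sg x (k * sg x)) ->
  (forall x, -1 <= x <= 2 -> normc (sg x) <= M) ->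
  mxintegral `]0, +oo[ (laplace_kernel (sg 1) P) =
  mxintegral `]0, +oo[ (laplace_kernel (sg 0) P) *m mxexp (k *: - P).
Proof.
move=> dP sg_pos dsg sgM'.
have M0 : 0 <= M.
  by apply: le_trans (sgM' 0 _); rewrite ?normc_ge0//; apply/andP; split; lra.
rewrite scalerN -scaleNr.
apply: (@mxexp_ode _ _ _ (fun x => mxintegral `]0, +oo[ (laplace_kernel (sg x) P))) => a a01.
have sa := sg_pos a a01.
pose dK x t := (- k * sg x * t%:C) *: laplace_kernel (sg x) P t.
pose rho := complex.Re (sg a) / 2.
have rho0 : 0 < rho by rewrite divr_gt0.
have [r r0 [r1 hr]] : exists2 r : R, 0 < r & r <= 1 /\
    forall x, a - r < x < a + r -> rho < complex.Re (sg x).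
  have [d1 _] := dsg a; have c1 := is_derive_continuous d1.
  have : \forall x \near a, rho < complex.Re (sg x).
    by apply: (cvgr_gt _ c1); rewrite /rho; lra.
  move=> /nbhs_ballP[r /= r0 hr].
  exists (Num.min r 1); first by rewrite lt_min r0 ltr01.
  split; first by rewrite ge_min lexx orbT.
  move=> x xI; apply: hr; rewrite /ball /= distrC ltr_norml.
  have : Num.min r 1 <= r by rewrite ge_min lexx.
  by move: xI => /andP[h1 h2] h3; apply/andP; split; lra.
clearbody rho.
have sgM x : a - r < x < a + r -> normc (sg x) <= M.
  move=> /andP[x1 x2]; apply: sgM'.
  by move: a01 => /andP[a0 a1]; apply/andP; split; lra.
have rho20 : 0 < rho / 2 by rewrite divr_gt0.
have [g [g0 gi hg]] := laplace_majorant dP rho20.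
pose c := normc k * M * (rho / 2)^-1.
have c0 : 0 <= c by rewrite !mulr_ge0 ?normc_ge0 ?expR_ge0 ?invr_ge0 ?(ltW rho20).
have cgi := integrable_scale c measurable_0y gi.
have dKx x t : mxder (fun y => laplace_kernel (sg y) P t) x (dK x t).
  rewrite /laplace_kernel.
  have d1 : cder (fun y => - sg y * t%:C) x (- k * sg x * t%:C).
    have d0 := cderM (cderM (dsg x) (cder_cst (-1) x)) (cder_cst t%:C x).
    have e0 : (fun y => sg y * -1 * t%:C) = (fun y => - sg y * t%:C).
      by apply/funext => y; rewrite mulrN1.
    rewrite e0 in d0; apply: cder_eq d0 _; ring.
  apply: mxder_eq (mxderZ (cder_cexp_comp d1) (mxder_cst _ x)) _.
  by rewrite scaler0 addr0 /dK /laplace_kernel scalerA.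
have dKg x t : a - r < x < a + r -> `]0, +oo[%classic t -> nrm (dK x t) <= c * g t.
  move=> xI; rewrite /= in_itv /= andbT => t0.
  rewrite /dK nrmZ normc_speed ?(ltW t0)// nrmZ normc_laplace.
  apply: (@le_trans _ _ (c * (expR (- (rho / 2) * t) * nrm (tpow t (P - 1%:M))))); last first.
    by rewrite ler_wpM2l// hg.
  rewrite !mulrA ler_wpM2r ?nrm_ge0// /c -!mulrA ler_wpM2l ?normc_ge0//.
  apply: ler_pM; rewrite ?normc_ge0 ?mulr_ge0 ?expR_ge0 ?(ltW t0)//; first exact: sgM.
  rewrite ler_pdivlMl//.
  have e1 : rho / 2 * t <= expR (rho / 2 * t) by apply: le_trans (expR_ge1Dx _); rewrite lerDr.
  rewrite mulrA; apply: le_trans (ler_wpM2r (expR_ge0 _) e1) _.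
  rewrite -expRD ler_expR.
  have : rho * t <= complex.Re (sg x) * t by rewrite ler_wpM2r ?(ltW t0)// ltW// hr.
  lra.
have Ki x : a - r < x < a + r -> mxintegrable `]0, +oo[ (laplace_kernel (sg x) P).
  by move=> xI; apply: laplace_integrable => //; apply: lt_trans (hr x xI).
have cg0 t : 0 <= c * g t by rewrite mulr_ge0.
apply: (mxder_eq (mxder_under_integral measurable_0y r0 Ki (fun x t _ _ => dKx x t) cg0 cgi dKg)).
have mom := laplace_moment 0 dP sa.
have J0 : mxintegral `]0, +oo[ (fun t => (t ^+ 0)%:C *: laplace_kernel (sg a) P t) =
    mxintegral `]0, +oo[ (laplace_kernel (sg a) P).
  by apply: mxintegral_ext => t _; rewrite expr0 scale1r.
rewrite J0 mulr0n raddf0 addr0 in mom.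
have [gg ggi hgg] := laplace_kernel_majorant dP sa.
have sa20 : 0 < complex.Re (sg a) / 2 by rewrite divr_gt0.
have D0 t : `]0, +oo[%classic t -> 0 <= t by rewrite /= in_itv /= andbT => /ltW.
have dE t : `]0, +oo[%classic t -> exists M, mxder (laplace_kernel (sg a) P) t M.
  by rewrite /= in_itv /= andbT => t0; eexists; exact: mxder_laplace.
have J1i := moment_integrable exhausts0y D0 sa20 dE ggi hgg 1.
rewrite (mxintegral_ext (G := fun t => ((t ^+ 1)%:C *: laplace_kernel (sg a) P t) *m
  (- k * sg a)%:M)); last first.
  by move=> t _; rewrite expr1 mul_mx_scalar scalerA /dK.
rewrite (mxintegralMr _ measurable_0y J1i).
rewrite -[(- k * sg a)%:M]scale_scalar_mx -[LHS]scalemxAr -[RHS]scalemxAr.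
exact: (congr1 (fun X => - k *: X) (esym mom)).
Qed.

(** The path is [exp (x ln s)]; its argument [x arg s] stays in ]- pi/2, pi/2[. *)
Lemma log_path s : 0 < complex.Re s ->
  exists (sg : R -> R[i]) M, [/\ sg 0 = 1, sg 1 = s,
    forall x, 0 <= x <= 1 -> 0 < complex.Re (sg x),
    forall x, cder sg x (cln s * sg x) &
    forall x, -1 <= x <= 2 -> normc (sg x) <= M].
Proof.
move=> s0; exists (fun x => cexp (x%:C * cln s)), (expR (2 * `|complex.Re (cln s)|)).
split=> [||x /andP[x0 x1]|x|x x12].
- by rewrite (_ : (0 : R)%:C = 0)// mul0r cexp0.
- by rewrite mul1r cexp_cln.
- rewrite cexpE; set re := complex.Re (_ * _); set im := complex.Im (_ * _).
  rewrite [complex.Re _]/= mulr_gt0 ?expR_gt0// cos_gt0_pihalf//.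
  rewrite -ltr_norml /im Im_mul /= mul0r addr0 normrM ger0_norm//.
  by apply: le_lt_trans (carg_lt_pihalf s0); rewrite ler_piMl.
- exact: cder_cexp.
- rewrite normc_cexp Re_mul [complex.Re x%:C]/= [complex.Im x%:C]/= mul0r subr0.
  by rewrite ler_expR mul_le_norm.
Qed.

Lemma laplace_base s P : decays P -> 0 < complex.Re s ->
  mxintegral `]0, +oo[ (laplace_kernel s P) = mxGamma P *m mxpow s (- P).
Proof.
move=> dP s0; have [sg [M [sg0 sg1 sg_pos dsg sgM]]] := log_path s0.
have h := laplace_path dP sg_pos dsg sgM; rewrite sg1 sg0 in h.
have g0 : mxintegral `]0, +oo[ (laplace_kernel 1 P) = mxGamma P.
  apply: mxintegral_ext => t; rewrite /= in_itv /= andbT => t0.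
  rewrite /laplace_kernel mxpow_real// mulN1r.
  have -> : - t%:C = (- t)%:C by rewrite rmorphN.
  by rewrite cexp_real.
apply: (etrans h).
exact: (congr1 (fun X => X *m mxexp (cln s *: - P)) g0).
Qed.

End Matrix.
End LaplaceBase.

(** * The two transforms of the hypergeometric function *)

Section Transforms.
Context {R : realType} {N : nat}.
Variables (A B C P Q : 'M[R[i]]_N).
Implicit Types (s z : R[i]) (t : R).
Hypotheses (uB : forall s : nat, B + s%:R%:M \in unitmx).
Hypotheses (uC : forall s : nat, C + s%:R%:M \in unitmx).
Hypotheses (cAP : comm_mx A P).
Hypotheses (dP : decays P).

Let uBC X : X \in [:: B; C] -> forall s : nat, X + s%:R%:M \in unitmx.
Proof. by rewrite !inE => /orP[] /eqP ->. Qed.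

Let term12 z k : mxhyp_term [:: A] [:: B; C] z k = (z ^+ k / k`!%:R) *:
  (mxpoch A k *m (invmx (mxpoch B k) *m invmx (mxpoch C k))).
Proof. by rewrite /mxhyp_term !big_cons !big_nil !mulr1. Qed.

Lemma laplace_moments s k : 0 < complex.Re s ->
  mxintegral `]0, +oo[ (fun t => (t ^+ k)%:C *: laplace_kernel s P t) =
  mxintegral `]0, +oo[ (laplace_kernel s P) *m ((s^-1) ^+ k *: mxpoch P k).
Proof.
move=> s0; have sn0 : s != 0 by apply: contraTneq s0 => ->; rewrite ltxx.
elim: k => [|k ih].
  rewrite expr0 scale1r mxpoch0 mulmx1; apply: mxintegral_ext => t _.
  by rewrite expr0 scale1r.
have := laplace_moment k dP s0; rewrite ih mul_mx_scalar.
set J := mxintegral _ (laplace_kernel s P); set J' := mxintegral _ _ => h.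
rewrite -[J'](scale1r) -(mulVf sn0) -scalerA -h mxpochS.
by rewrite -!scalemxAr -scalemxAl scalerA -exprS mulmxA.
Qed.

Lemma laplace_hyp z s : 0 < complex.Re s ->
  let f t := cexp (- s * t%:C) *: (mxpow t%:C (P - 1%:M) *m
    mxhyp [:: A] [:: B; C] (z * t%:C)) in
  mxintegrable `]0, +oo[ f /\ mxintegral `]0, +oo[ f =
    mxGamma P *m mxpow s (- P) *m mxhyp [:: A; P] [:: B; C] (z / s).
Proof.
move=> s0 f; have s20 : 0 < complex.Re s / 2 by rewrite divr_gt0.
have [g gi hg] := laplace_kernel_majorant dP s0.
have D0 t : `]0, +oo[%classic t -> 0 <= t by rewrite /= in_itv /= andbT => /ltW.
have dE t : `]0, +oo[%classic t -> exists M, mxder (laplace_kernel s P) t M.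
  by rewrite /= in_itv /= andbT => t0; eexists; exact: mxder_laplace.
have fE t : `]0, +oo[%classic t ->
    laplace_kernel s P t *m mxhyp [:: A] [:: B; C] (z * t%:C) = f t.
  rewrite /= in_itv /= andbT => t0.
  by rewrite /f mxpow_real// /laplace_kernel -scalemxAl.
have VT k : ((s^-1) ^+ k *: mxpoch P k) *m mxhyp_term [:: A] [:: B; C] z k =
    mxhyp_term [:: A; P] [:: B; C] (z / s) k.
  rewrite term12 /mxhyp_term !big_cons !big_nil !mulr1.
  have cAPk : comm_mx (mxpoch A k) (mxpoch P k).
    by apply: comm_poch; apply/comm_mx_sym; apply: comm_poch; exact/comm_mx_sym.
  move: (mxpoch A k) (mxpoch P k) (invmx (mxpoch B k)) (invmx (mxpoch C k)) cAPk.
  rewrite /comm_mx => a p b c cap.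
  change (s^-1 ^+ k *: p *m ((z ^+ k / k`!%:R) *: (a *m (b *m c))) =
    ((z / s) ^+ k / k`!%:R) *: ((a *m p) *m (b *m c))).
  rewrite cap -scalemxAl -scalemxAr scalerA !mulmxA exprMn.
  by congr (_ *: _); ring.
have cv : mxcvg (fun n => \sum_(0 <= k < n) mxhyp_term [:: A; P] [:: B; C] (z / s) k)
    (mxhyp [:: A; P] [:: B; C] (z / s)) by exact: (@mxhyp_cvg _ _ _ _ _ 0).
have [fi feq] := mxhyp_integral exhausts0y D0 s20 dE gi hg (erefl : size [:: B; C] = (size [:: A]).+1) uBC
  (fun k => laplace_moments k s0) VT cv.
split; first exact: mxintegrable_ext measurable_0y fE fi.
rewrite (laplace_base dP s0) in feq.
exact: etrans (esym (mxintegral_ext fE)) feq.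
Qed.

Hypotheses (cAQ : comm_mx A Q) (cBP : comm_mx B P) (cBQ : comm_mx B Q).
Hypotheses (cCP : comm_mx C P) (cCQ : comm_mx C Q) (cPQ : comm_mx P Q).
Hypotheses (dQ : decays Q).

Let uPQ k : P + Q + k%:R%:M \in unitmx.
Proof. by apply: decays_unit; exact: decaysD. Qed.

Lemma beta_moments k :
  mxintegral `]0, 1[ (fun t => (t ^+ k)%:C *: beta_kernel P Q t) =
  mxintegral `]0, 1[ (beta_kernel P Q) *m (mxpoch P k *m invmx (mxpoch (P + Q) k)).
Proof.
elim: k => [|k ih].
  rewrite !mxpoch0 invmx1 !mulmx1; apply: mxintegral_ext => t _.
  by rewrite expr0 scale1r.
have := beta_moment k cPQ dP dQ; rewrite ih.
set J := mxintegral _ (beta_kernel P Q); set J' := mxintegral _ _ => h.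
rewrite -[J'](mulmxK (uPQ k)) -h invmx_pochS// mxpochS.
have cS : comm_mx (P + k%:R%:M) (invmx (mxpoch (P + Q) k)).
  apply/comm_mxV/comm_poch/comm_mx_sym/comm_mxD; last exact: comm_mx_scalar.
  by apply/comm_mx_sym/comm_mxD.
have cW : comm_mx (invmx (P + Q + k%:R%:M)) (invmx (mxpoch (P + Q) k)).
  apply/comm_mxV/comm_poch/comm_mx_sym/comm_mxV/comm_mxD => //.
  exact: comm_mx_scalar.
by rewrite cW -!mulmxA; congr (_ *m (_ *m _)); rewrite !mulmxA cS.
Qed.

Lemma beta_hyp z :
  let f t := mxpow t%:C (P - 1%:M) *m mxpow (1 - t)%:C (Q - 1%:M) *m
    mxhyp [:: A] [:: B; C] (z * t%:C) in
  mxintegrable `]0, 1[ f /\ mxintegral `]0, 1[ f =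
    mxBeta P Q *m mxhyp [:: A; P] [:: B; C; P + Q] z.
Proof.
move=> f; have [g gi hg] := beta_kernel_majorant dP dQ.
have m01 : measurable (`]0 : R, 1[ : set R) by exact: exh_measurable exhausts01.
have D0 t : `]0, 1[%classic t -> 0 <= t by rewrite /= in_itv /= => /andP[/ltW].
have dE t : `]0, 1[%classic t -> exists M, mxder (beta_kernel P Q) t M.
  by rewrite /= in_itv /= => t01; eexists; exact: mxder_beta.
have kE t : `]0, 1[%classic t -> beta_kernel P Q t =
    mxpow t%:C (P - 1%:M) *m mxpow (1 - t)%:C (Q - 1%:M).
  rewrite /= in_itv /= => /andP[t0 t1].
  by rewrite !mxpow_real// subr_gt0.
have fE t : `]0, 1[%classic t ->
    beta_kernel P Q t *m mxhyp [:: A] [:: B; C] (z * t%:C) = f t.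
  by move=> /kE ->.
have uBCPQ X : X \in [:: B; C; P + Q] -> forall s : nat, X + s%:R%:M \in unitmx.
  by rewrite !inE => /or3P[] /eqP ->.
have VT k : (mxpoch P k *m invmx (mxpoch (P + Q) k)) *m
    mxhyp_term [:: A] [:: B; C] z k = mxhyp_term [:: A; P] [:: B; C; P + Q] z k.
  rewrite term12 /mxhyp_term !big_cons !big_nil !mulr1 -[LHS]scalemxAr.
  have cAPk : comm_mx (mxpoch A k) (mxpoch P k).
    by apply: comm_poch; apply/comm_mx_sym; apply: comm_poch; exact/comm_mx_sym.
  have cI X : comm_mx X P -> comm_mx X Q -> comm_mx X (invmx (mxpoch (P + Q) k)).
    by move=> h1 h2; apply/comm_mxV/comm_poch/comm_mxD.
  have cIA : comm_mx (invmx (mxpoch (P + Q) k)) (mxpoch A k).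
    by apply/comm_poch/comm_mx_sym/cI.
  have cIB : comm_mx (invmx (mxpoch (P + Q) k)) (invmx (mxpoch B k)).
    by apply/comm_mxV/comm_poch/comm_mx_sym/cI.
  have cIC : comm_mx (invmx (mxpoch (P + Q) k)) (invmx (mxpoch C k)).
    by apply/comm_mxV/comm_poch/comm_mx_sym/cI.
  move: (mxpoch A k) (mxpoch P k) (invmx (mxpoch B k)) (invmx (mxpoch C k))
    (invmx (mxpoch (P + Q) k)) cAPk cIA cIB cIC => a p b c i; rewrite /comm_mx.
  move=> cap cia cib cic.
  apply: (congr1 (fun X => (z ^+ k / k`!%:R) *: X)).
  change (p *m i *m (a *m (b *m c)) = (a *m p) *m (b *m (c *m i))).
  by rewrite cap -cic [b *m (_ *m _)]mulmxA -cib -!mulmxA [i *m (a *m _)]mulmxA cia -!mulmxA.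
have cv : mxcvg (fun n => \sum_(0 <= k < n) mxhyp_term [:: A; P] [:: B; C; P + Q] z k)
    (mxhyp [:: A; P] [:: B; C; P + Q] z) by exact: (@mxhyp_cvg _ _ _ _ _ 1).
have [fi feq] := mxhyp_integral exhausts01 D0 ltr01 dE gi hg (erefl : size [:: B; C] = (size [:: A]).+1) uBC
  beta_moments VT cv.
split; first exact: mxintegrable_ext m01 fE fi.
have BE : mxintegral `]0, 1[ (beta_kernel P Q) = mxBeta P Q := mxintegral_ext kE.
by rewrite BE in feq; exact: etrans (esym (mxintegral_ext fE)) feq.
Qed.

End Transforms.

Unset Implicit Arguments.
Set Strict Implicit.
Set Printing Implicit Defensive.

Theorem theorem3p1 (R : realType) (N : nat) (A B C P Q : 'M[R[i]]_N)
    (hcomm : pairwise (@comm_mxb R[i] N) [:: A; B; C; P; Q])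
    (hB : forall s : nat, B + s%:R%:M \in unitmx)
    (hC : forall s : nat, C + s%:R%:M \in unitmx)
    (hP : positive_stable P) (hQ : positive_stable Q) :
  (forall z : R[i],
     let f (t : R) :=
       mxpow t%:C (P - 1%:M) *m mxpow (1 - t)%:C (Q - 1%:M)
         *m mxhyp [:: A] [:: B; C] (z * t%:C) in
     mxintegrable `]0, 1[ f /\
     mxintegral `]0, 1[ f =
       mxBeta P Q *m mxhyp [:: A; P] [:: B; C; P + Q] z) /\
  (forall z s : R[i], 0 < complex.Re s ->
     let f (t : R) :=
       cexp (- s * t%:C) *: (mxpow t%:C (P - 1%:M)
         *m mxhyp [:: A] [:: B; C] (z * t%:C)) in
     mxintegrable `]0, +oo[ f /\
     mxintegral `]0, +oo[ f =
       mxGamma P *m mxpow s (- P) *m mxhyp [:: A; P] [:: B; C] (z / s)).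
Proof.
have [/allP cA /andP[/allP cB /andP[/allP cC /andP[/allP cP _]]]] := andP hcomm.
have cAP : comm_mx A P by apply/comm_mxP/cA; rewrite !inE eqxx !orbT.
have cAQ : comm_mx A Q by apply/comm_mxP/cA; rewrite !inE eqxx !orbT.
have cBP : comm_mx B P by apply/comm_mxP/cB; rewrite !inE eqxx !orbT.
have cBQ : comm_mx B Q by apply/comm_mxP/cB; rewrite !inE eqxx !orbT.
have cCP : comm_mx C P by apply/comm_mxP/cC; rewrite !inE eqxx.
have cCQ : comm_mx C Q by apply/comm_mxP/cC; rewrite !inE eqxx orbT.
have cPQ : comm_mx P Q by apply/comm_mxP/cP; rewrite inE.
have dP := positive_stable_decays hP; have dQ := positive_stable_decays hQ.
split=> [z|z s s0]; first exact: beta_hyp.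
exact: laplace_hyp.
Qed.
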